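(* Consider the PVRD$^2$ algorithm with pipeline depth $J\ge 1$ and constant step-size $\mu>0$, as defined in the context, under the standing assumptions listed there. There exists $\bar\mu>0$ such that for every step-size $0<\mu\le\bar\mu$ there is a constant $C<\infty$ (independent of $i$) with $$\mathbb{E}\,\|w_{i,k}-w^\star_k\|^2\le \rho^i C\qquad\text{for all agents }k\text{ and all } i>0,$$ where $w^\star=\mathrm{col}\{w_1^\star,\dots,w_K^\star\}$ is the minimizer of $R$, the expectation is over the random sample indices, and $$\rho=\max\Big(1-\frac{1-\lambda^J}{2N},\;1-\frac{\mu\nu}{5}\Big).$$
   Context: Data and risk. There are $N$ data pairs $(h_n,\gamma_n)$, $n=1,\dots,N$, with $h_n\in\mathbb{R}^M$ and scalar labels $\gamma_n$. The feature vector and the parameter are partitioned into $K$ blocks, $h_n=\mathrm{col}\{h_{n,1},\dots,h_{n,K}\}$, $w=\mathrm{col}\{w_1,\dots,w_K\}$ with $h_{n,k},w_k\in\mathbb{R}^{M_k}$, $\sum_k M_k=M$; block $k$ is held by agent $k$. The empirical risk is $$R(w)=\frac1N\sum_{n=1}^N Q\Big(\sum_{k=1}^K h_{n,k}^{\mathsf T}w_k;\gamma_n\Big)+\sum_{k=1}^K r_k(w_k),$$ where $Q(\cdot;\gamma):\mathbb{R}\to\mathbb{R}$ is differentiable with derivative $\nabla_z Q(z;\gamma)$, and $r(w)=\sum_k r_k(w_k)$. Assumptions. (i) For every $n$, the map $w\mapsto Q(h_n^{\mathsf T}w;\gamma_n)$ has $L$-Lipschitz gradient, i.e. $\|\nabla_zQ(h_n^{\mathsf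 T}w_1;\gamma_n)h_n-\nabla_zQ(h_n^{\mathsf T}w_2;\gamma_n)h_n\|\le L\|w_1-w_2\|$, and $|\nabla_zQ(z_1;\gamma_n)-\nabla_zQ(z_2;\gamma_n)|\le\delta|z_1-z_2|$ for all $z_1,z_2$, with $L,\delta>0$. (ii) $r$ is convex with $\eta$-Lipschitz gradient. (iii) $R$ is $\nu$-strongly convex: $(\nabla R(w_1)-\nabla R(w_2))^{\mathsf T}(w_1-w_2)\ge\nu\|w_1-w_2\|^2$; $w^\star$ denotes its unique minimizer. (iv) Agents communicate over a strongly connected graph with combination matrix $A=[a_{\ell k}]\in\mathbb{R}^{K\times K}$, nonnegative, with $a_{\ell k}>0$ only if $\ell=k$ or $\ell$ is a neighbor of $k$ ($\ell\in\mathcal N_k$, where $\mathcal N_k$ includes $k$), $A=A^{\mathsf T}$, $A\mathbf 1_K=\mathbf 1_K$, and $a_{kk}>0$ for at least one $k$. $\lambda\in(0,1)$ denotes the second largest magnitude of the eigenvalues of $A$. PVRD$^2$ algorithm (pipelined variance-reduced dynamic diffusion). Each agent $k$ stores $w_{i,k}$ and scalar tables $u^i_{n,k},v^i_{n,k}$, $n=1,\dots,N$, initialized $w_{1,k}=0$ (equivalently $w_{0,k}=0$), $u^1_{n,k}=v^1_{n,k}=0$. At each iteration $i=1,2,\dots$ an index $n_i$ is drawn uniformly from $\{1,\dots,N\}$, independently of the past, and the same $n_i$ is used by all agents. Agent $k$ forms $z^{(0)}_{n_i,k}=u^i_{n_i,k}+Kh_{n_i,k}^{\mathsf T}w_{i,k}-v^i_{n_i,k}$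 and records $p_{i,k}=Kh_{n_i,k}^{\mathsf T}w_{i,k}$. Pipeline: at iteration $i$, for each $j=0,\dots,J-1$ with $i-j\ge1$, agents compute $z^{(j+1)}_{n_{i-j},k}=\sum_{\ell\in\mathcal N_k}a_{\ell k}z^{(j)}_{n_{i-j},\ell}$ (one communication of a length-$J$ vector per iteration). For $i\ge J$, let $n'_i=n_{i-J+1}$ and update $$w_{i+1,k}=w_{i,k}-\mu\Big\{\big[\nabla_zQ(z^{(J)}_{n'_i,k};\gamma_{n'_i})-\nabla_zQ(u^i_{n'_i,k};\gamma_{n'_i})\big]h_{n'_i,k}+\frac1N\sum_{n=1}^N\nabla_zQ(u^i_{n,k};\gamma_n)h_{n,k}+\nabla r_k(w_{i,k})\Big\},$$ then set $u^{i+1}_{n'_i,k}=z^{(J)}_{n'_i,k}$, $v^{i+1}_{n'_i,k}=p_{i-J+1,k}$, and $u^{i+1}_{n,k}=u^i_{n,k}$, $v^{i+1}_{n,k}=v^i_{n,k}$ for $n\ne n'_i$. (During the warm-up iterations $i<J$ no quantity has yet exited the pipeline; $w$ and the tables are left unchanged.) *)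

(* Defs.v *)
From Stdlib Require Import Reals.
From mathcomp Require Import all_boot.


Open Scope R_scope.

Definition osum {m : nat} (f : 'I_m -> R) : R :=
  foldr Rplus 0 (map f (enum (ordinal m))).

Definition blkdot {m : nat} (x y : 'I_m -> R) : R := osum (fun j => x j * y j).

(* block vectors of R^M, M = sum_k M_k, partitioned into K blocks of sizes M k *)
Definition Vec {K : nat} (M : 'I_K -> nat) : Type := forall k : 'I_K, 'I_(M k) -> R.

Definition vdot {K : nat} {M : 'I_K -> nat} (x y : Vec M) : R :=
  osum (fun k => blkdot (x k) (y k)).
Definition vnorm {K : nat} {M : 'I_K -> nat} (x : Vec M) : R := sqrt (vdot x x).
Definition vsub {K : nat} {M : 'I_K -> nat} (x y : Vec M) : Vec M :=
  fun k j => x k j - y k j.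
Definition vscale {K : nat} {M : 'I_K -> nat} (c : R) (x : Vec M) : Vec M :=
  fun k j => c * x k j.
Definition vadd {K : nat} {M : 'I_K -> nat} (x y : Vec M) : Vec M :=
  fun k j => x k j + y k j.

Section Risk.
Variables (N K : nat) (M : 'I_K -> nat).
Variable h : 'I_N -> Vec M.
Variable gamma : 'I_N -> R.
Variable Q : R -> R -> R.             (* Q z gamma *)
Variable dQ : R -> R -> R.            (* its derivative in z *)
Variable r : forall k : 'I_K, ('I_(M k) -> R) -> R.
Variable grad_r : forall k : 'I_K, ('I_(M k) -> R) -> 'I_(M k) -> R.

Definition rsum (w : Vec M) : R := osum (fun k => r k (w k)).

Definition risk (w : Vec M) : R :=
  / INR N * osum (fun n => Q (vdot (h n) w) (gamma n)) + rsum w.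

Definition gradQn (n : 'I_N) (w : Vec M) : Vec M :=
  vscale (dQ (vdot (h n) w) (gamma n)) (h n).

Definition grad_rsum (w : Vec M) : Vec M := fun k => grad_r k (w k).

Definition grad_risk (w : Vec M) : Vec M :=
  fun k j => / INR N * osum (fun n => (gradQn n w : Vec M) k j) + grad_r k (w k) j.
End Risk.

(* lam is the second largest magnitude among the eigenvalues (counted with
   multiplicity) of the symmetric matrix a: the eigenvalues of a real
   symmetric matrix, with multiplicity, are the diagonal entries e of an
   orthogonal diagonalisation a = U diag(e) U^T; listing them by
   nonincreasing magnitude, lam is the magnitude of the second one. *)
Definition second_largest_eig_mag {K : nat} (a : 'I_K -> 'I_K -> R) (lam : R) : Prop :=
  exists (U : 'I_K -> 'I_K -> R) (e : 'I_K -> R),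
    (forall p q : 'I_K, osum (fun l => U l p * U l q) = if p == q then 1 else 0) /\
    (forall l k : 'I_K, a l k = osum (fun p => U l p * e p * U k p)) /\
    (forall p q : 'I_K, (p <= q)%N -> Rabs (e q) <= Rabs (e p)) /\
    (exists p : 'I_K, nat_of_ord p = 1%N /\ lam = Rabs (e p)).

Record St (N K : nat) (M : 'I_K -> nat) : Type := mkSt {
  sw : Vec M;
  su : 'I_N -> 'I_K -> R;
  sv : 'I_N -> 'I_K -> R
}.
Arguments mkSt {N K M}.
Arguments sw {N K M}.
Arguments su {N K M}.
Arguments sv {N K M}.

Section PVRD2.
Variables (N K : nat) (M : 'I_K -> nat).
Variable h : 'I_N -> Vec M.
Variable gamma : 'I_N -> R.
Variable dQ : R -> R -> R.
Variable grad_r : forall k : 'I_K, ('I_(M k) -> R) -> 'I_(M k) -> R.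
Variable a : 'I_K -> 'I_K -> R.
Variable nb : rel 'I_K.               (* nb l k : l is a neighbour of k *)
Variable J : nat.
Variable mu : R.
Variable ns : nat -> 'I_N.            (* ns i = n_i, the index drawn at iteration i >= 1 *)

Definition init_st : St N K M :=
  mkSt (fun _ _ => 0) (fun _ _ => 0) (fun _ _ => 0).

Definition prec (prev : nat -> St N K M) (t : nat) (k : 'I_K) : R :=
  INR K * blkdot (h (ns t) k) (sw (prev t) k).

(* zitem prev t j k = z^{(j)}_{n_t,k}: the quantity entering the pipeline at
   iteration t after j combination steps (step j -> j+1 is performed at
   iteration t+j).  prev t is the state (w_t, u^t, v^t) at iteration t. *)
Fixpoint zitem (prev : nat -> St N K M) (t j : nat) (k : 'I_K) : R :=
  match j with
  | O => let S := prev t in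
         su S (ns t) k + prec prev t k - sv S (ns t) k
  | S j' => osum (fun l : 'I_K =>
              if (l == k) || nb l k then a l k * zitem prev t j' l else 0)
  end.

(* one iteration i: from the states at iterations <= i, compute the state
   at iteration i+1 *)
Definition step (i : nat) (prev : nat -> St N K M) : St N K M :=
  let S := prev i in
  if (i < J)%N then S else
  let t := (i - J).+1 in
  let n' := ns t in
  let zJ := zitem prev t J in
  mkSt
    (fun k j => sw S k j - mu *
        ((dQ (zJ k) (gamma n') - dQ (su S n' k) (gamma n')) * h n' k j
         + / INR N * osum (fun n => dQ (su S n k) (gamma n) * h n k j)
         + grad_r k (sw S k) j))
    (fun n k => if n == n' then zJ k else su S n k)
    (fun n k => if n == n' then prec prev t k else sv S n k).

(* traj m t = state at iteration t, valid for 1 <= t <= m+1 *)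
Fixpoint traj (m : nat) : nat -> St N K M :=
  match m with
  | O => fun _ => init_st
  | S m' => let pr := traj m' in
            fun t => if (t <= m)%N then pr t else step m pr
  end.

(* state (w_i, u^i, v^i) at iteration i >= 1 *)
Definition state (i : nat) : St N K M := traj i i.

Definition w_iter (i : nat) (k : 'I_K) : 'I_(M k) -> R := sw (state i) k.
End PVRD2.

Fixpoint sum_lists {N : nat} (L : nat) (g : seq 'I_N -> R) : R :=
  match L with
  | O => g [::]
  | S L' => osum (fun n : 'I_N => sum_lists L' (fun s => g (n :: s)))
  end.

(* E[f(n_1, n_2, ...)] where f only depends on n_1,...,n_L and the n_t are
   i.i.d. uniform on 'I_N; d0 fills the (irrelevant) positions t > L. *)
Definition expect_first {N : nat} (d0 : 'I_N) (L : nat)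
    (f : (nat -> 'I_N) -> R) : R :=
  sum_lists L (fun s => f (fun t => nth d0 s t.-1)) / INR N ^ L.

Arguments rsum {K M}.
Arguments risk {N K M}.
Arguments gradQn {N K M}.
Arguments grad_rsum {K M}.
Arguments grad_risk {N K M}.
Arguments init_st {N K M}.
Arguments prec {N K M}.
Arguments zitem {N K M}.
Arguments step {N K M}.
Arguments traj {N K M}.
Arguments state {N K M}.
Arguments w_iter {N K M}.

(* Main.v *)
Require Import Defs.
From HB Require Import structures.
From Stdlib Require Import Reals Lra FunctionalExtensionality.
From mathcomp Require Import all_boot.
Open Scope R_scope.

(* For small step-sizes the claimed rate is 1 - mu nu / 5, so it suffices to
   beat that one; all other error modes contract at a rate independent of mu.
   Besides the squared distance W to the minimizer, follow the dispersion C of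
   the tables u across agents and the staleness D of the tables v.  The sums
   of u and of v over agents coincide at all times, so C and D control the
   distance of the tables, and of the quantities leaving the pipeline, to the
   true outputs h_n^T w.  The index consumed at iteration i is independent of
   the states up to time i, and averaging over it makes the descent direction
   equal to grad R(w_i) up to an error controlled by C, D and the movement of
   w over the last J iterations, which is O(mu).  The resulting delayed
   inequalities propagate E W_i <= G rho^i, E D_i <= mu G rho^i and
   E C_i <= const mu G rho^i. *)

(** * Finite sums *)

(** The weights in the final bounds come from balancing powers of [mu]. The update direction is
    small whenever the errors are small, with no residual noise term, so the squared move of one
    iteration is [mu^2] times the total error. Moves are what drives the staleness, hence a
    staleness of order [mu G rho^i] propagates with room to spare; staleness in turn drives
    dispersion, with a fixed ratio. Both enter the distance recursion with one more factor [mu], so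
    their effect is of order [mu^2]. This must fit in the slack of the descent: strong convexity
    offers [2 mu nu], a Young inequality spends half of it on the gradient error, and the target
    rate claims only [mu nu / 5], which leaves [4/5 mu nu]. The obstacle is the delay. The bound at
    time [i+1] calls on moves in the last [J] iterations, and each of them on a state up to [J]
    iterations older. Since [mu] may depend on [J], it is taken so small that [rho^(2J) >= 1/2];
    looking back then costs a factor 2 at most. *)

Lemma RplusA : associative Rplus.
Proof. by move=> x y z; rewrite Rplus_assoc. Qed.

HB.instance Definition _ :=
  Monoid.isComLaw.Build R 0 Rplus RplusA Rplus_comm Rplus_0_l.

Lemma osumE m (f : 'I_m -> R) : osum f = \big[Rplus/0]_(i < m) f i.
Proof. by rewrite /osum foldrE big_map big_enum. Qed.

Lemma osum_ext m (f g : 'I_m -> R) : (forall i, f i = g i) -> osum f = osum g.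
Proof. by move=> fg; rewrite /osum (eq_map fg). Qed.

Lemma osum_add m (f g : 'I_m -> R) :
  osum (fun i => f i + g i) = osum f + osum g.
Proof. by rewrite !osumE big_split. Qed.

Lemma osum_scal m (c : R) (f : 'I_m -> R) :
  osum (fun i => c * f i) = c * osum f.
Proof.
rewrite !osumE; elim/big_rec2: _ => [|i x y _ ->]; first by rewrite Rmult_0_r.
by rewrite Rmult_plus_distr_l.
Qed.

Lemma osum_sub m (f g : 'I_m -> R) :
  osum (fun i => f i - g i) = osum f - osum g.
Proof.
rewrite (osum_ext m _ (fun i => f i + -1 * g i)); last by move=> i; lra.
by rewrite osum_add osum_scal; lra.
Qed.

Lemma osum_le m (f g : 'I_m -> R) : (forall i, f i <= g i) -> osum f <= osum g.
Proof.
move=> fg; rewrite !osumE; elim/big_rec2: _ => [|i x y _ xy]; first lra.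
by have := fg i; lra.
Qed.

Lemma osum_const m (c : R) : osum (fun _ : 'I_m => c) = INR m * c.
Proof.
rewrite osumE big_const_ord; elim: m => [|m IH]; first by rewrite /=; lra.
by rewrite iterS IH S_INR; lra.
Qed.

Lemma osum_ge0 m (f : 'I_m -> R) : (forall i, 0 <= f i) -> 0 <= osum f.
Proof. by move/osum_le; rewrite osum_const; lra. Qed.

Lemma osum_exchange m n (f : 'I_m -> 'I_n -> R) :
  osum (fun i => osum (f i)) = osum (fun j => osum (fun i => f i j)).
Proof.
rewrite (osum_ext m _ (fun i => \big[Rplus/0]_j f i j)); last by move=> i; exact: osumE.
rewrite (osum_ext n _ (fun j => \big[Rplus/0]_i f i j)); last by move=> i; exact: osumE.
by rewrite !osumE exchange_big.
Qed.

Lemma osum_delta m (p : 'I_m) (f : 'I_m -> R) :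
  osum (fun i => if i == p then f i else 0) = f p.
Proof. by rewrite osumE -big_mkcond big_pred1_eq. Qed.

Lemma osum_update m (p : 'I_m) (f g : 'I_m -> R) :
  osum (fun i => if i == p then f i else g i) = osum g + (f p - g p).
Proof.
rewrite -(osum_delta m p (fun i => f i - g i)) -osum_add.
by apply: osum_ext => i; case: eqP => _; lra.
Qed.

Lemma osum_term_le m (f : 'I_m -> R) (p : 'I_m) :
  (forall i, 0 <= f i) -> f p <= osum f.
Proof.
move=> f0; rewrite -{1}(osum_delta m p f); apply: osum_le => i.
by case: eqP => _; have := f0 i; lra.
Qed.

Lemma osum_eq0 m (f : 'I_m -> R) :
  (forall i, 0 <= f i) -> osum f = 0 -> forall i, f i = 0.
Proof. by move=> f0 s0 i; have := osum_term_le m f i f0; have := f0 i; lra. Qed.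

Lemma osum_mul_r m (c : R) (f : 'I_m -> R) :
  osum (fun i => f i * c) = osum f * c.
Proof. by rewrite Rmult_comm -osum_scal; apply: osum_ext => i; lra. Qed.

Lemma osum_mul m n (f : 'I_m -> R) (g : 'I_n -> R) :
  osum (fun i => osum (fun j => f i * g j)) = osum f * osum g.
Proof. by rewrite -osum_mul_r; apply: osum_ext => i; rewrite osum_scal. Qed.

(** * Euclidean geometry of rows and block vectors *)

Lemma blkdot_ge0 m (x : 'I_m -> R) : 0 <= blkdot x x.
Proof. by apply: osum_ge0 => i; exact: Rle_0_sqr. Qed.

(* Lagrange's identity. *)
Lemma blkdot_CS m (x y : 'I_m -> R) :
  blkdot x y * blkdot x y <= blkdot x x * blkdot y y.
Proof.
have: 0 <= osum (fun i => osum (fun j => (x i * y j - x j * y i) * (x i * y j - x j * y i))).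
  by apply: osum_ge0 => i; apply: osum_ge0 => j; exact: Rle_0_sqr.
rewrite (osum_ext _ _ (fun i =>
   osum (fun j => x i * x i * (y j * y j)) - 2 * osum (fun j => x i * y i * (x j * y j))
   + osum (fun j => y i * y i * (x j * x j)))); last first.
  move=> i; rewrite -osum_scal -osum_sub -osum_add.
  by apply: osum_ext => j; ring.
rewrite osum_add osum_sub osum_scal !osum_mul /blkdot; lra.
Qed.

Lemma sq_young (e a b : R) : 0 < e ->
  (a + b) * (a + b) <= (1 + e) * (a * a) + (1 + / e) * (b * b).
Proof.
move=> e0; have ie : e * / e = 1 by field; lra.
have ie0 := Rinv_0_lt_compat _ e0.
suff: 0 <= / e * ((e * a - b) * (e * a - b)).
  by rewrite (_ : _ * _ = (e * / e) * e * (a * a) - 2 * (e * / e) * (a * b) + / e * (b * b));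
    [rewrite ie; nra | ring].
by apply: Rmult_le_pos; [lra | exact: Rle_0_sqr].
Qed.

Lemma blkdot_young m (e : R) (z x y : 'I_m -> R) : 0 < e ->
  (forall j, z j = x j + y j) ->
  blkdot z z <= (1 + e) * blkdot x x + (1 + / e) * blkdot y y.
Proof.
move=> e0 zE; rewrite /blkdot -!osum_scal -osum_add; apply: osum_le => j.
by rewrite zE; exact: sq_young.
Qed.

Definition sqdist {K : nat} {M : 'I_K -> nat} (x y : Vec M) : R :=
  vdot (vsub x y) (vsub x y).

Section VecGeometry.
Variables (K : nat) (M : 'I_K -> nat).
Implicit Types x y z : Vec M.

Lemma vdot_ge0 x : 0 <= vdot x x.
Proof. by apply: osum_ge0 => k; exact: blkdot_ge0. Qed.

Lemma vdot_le x y (c : R) :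
  (forall k j, x k j * x k j <= c * (y k j * y k j)) -> vdot x x <= c * vdot y y.
Proof.
move=> xy; rewrite /vdot -osum_scal; apply: osum_le => k.
by rewrite /blkdot -osum_scal; apply: osum_le.
Qed.

Lemma vdot_young (e : R) z x y : 0 < e ->
  (forall k j, z k j = x k j + y k j) ->
  vdot z z <= (1 + e) * vdot x x + (1 + / e) * vdot y y.
Proof.
move=> e0 zE; rewrite /vdot -!osum_scal -osum_add; apply: osum_le => k.
exact: blkdot_young.
Qed.

Lemma vdot_split2 z x y : (forall k j, z k j = x k j + y k j) ->
  vdot z z <= 2 * vdot x x + 2 * vdot y y.
Proof. by move/(vdot_young 1 z x y Rlt_0_1); rewrite Rinv_1; lra. Qed.

Lemma vdot_ext x x' y y' : (forall k j, x k j = x' k j) ->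
  (forall k j, y k j = y' k j) -> vdot x y = vdot x' y'.
Proof.
move=> xE yE; apply: osum_ext => k; apply: osum_ext => j.
by rewrite xE yE.
Qed.

Lemma vdotD x y y' : vdot x (vadd y y') = vdot x y + vdot x y'.
Proof.
rewrite /vdot -osum_add; apply: osum_ext => k.
by rewrite /blkdot -osum_add; apply: osum_ext => j; rewrite /vadd; ring.
Qed.

Lemma vdotZ c x y : vdot x (vscale c y) = c * vdot x y.
Proof.
rewrite /vdot -osum_scal; apply: osum_ext => k.
by rewrite /blkdot -osum_scal; apply: osum_ext => j; rewrite /vscale; ring.
Qed.

Lemma vdotC x y : vdot x y = vdot y x.
Proof. by apply: osum_ext => k; apply: osum_ext => j; ring. Qed.

Lemma vdot_le_young (e : R) x y : 0 < e ->
  2 * vdot x y <= e * vdot x x + / e * vdot y y.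
Proof.
move=> e0; rewrite -vdotZ /vdot -!osum_scal -osum_add; apply: osum_le => k.
rewrite /blkdot -!osum_scal -osum_add; apply: osum_le => j; rewrite /vscale.
by have := sq_young e (x k j) (y k j) e0; nra.
Qed.

Lemma sqdist_ge0 x y : 0 <= sqdist x y.
Proof. exact: vdot_ge0. Qed.

Lemma sqdistxx x : sqdist x x = 0.
Proof.
rewrite /sqdist /vdot (osum_ext _ _ (fun=> 0)) ?osum_const; first ring.
move=> k; rewrite /blkdot (osum_ext _ _ (fun=> 0)) ?osum_const; first ring.
by move=> j; rewrite /vsub; ring.
Qed.

Lemma sqdistC x y : sqdist x y = sqdist y x.
Proof. by apply: osum_ext => k; apply: osum_ext => j; rewrite /vsub; ring. Qed.

Lemma sqdist_triangle y x z : sqdist x z <= 2 * sqdist x y + 2 * sqdist y z.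
Proof. by apply: vdot_split2 => k j; rewrite /vsub; ring. Qed.

End VecGeometry.

(** * Averages over agents and the combination matrix *)

Definition mean {K : nat} (x : 'I_K -> R) : R := osum x / INR K.
Definition centered {K : nat} (x : 'I_K -> R) : 'I_K -> R := fun k => x k - mean x.
Definition dispersion {K : nat} (x : 'I_K -> R) : R := blkdot (centered x) (centered x).
Definition combine {K : nat} (a : 'I_K -> 'I_K -> R) (x : 'I_K -> R) : 'I_K -> R :=
  fun k => osum (fun l => a l k * x l).

Section Combination.
Variable (K : nat).
Hypothesis HK : (0 < K)%N.

Lemma INR_K_gt0 : 0 < INR K.
Proof. by apply: lt_0_INR; apply/ltP. Qed.

Lemma osum_mean (x : 'I_K -> R) : osum x = INR K * mean x.
Proof. by have K0 := INR_K_gt0; rewrite /mean; field; lra. Qed.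

Lemma osum_centered (x : 'I_K -> R) : osum (centered x) = 0.
Proof. by rewrite /centered osum_sub osum_const -osum_mean; lra. Qed.

Lemma dispersion_ge0 (x : 'I_K -> R) : 0 <= dispersion x.
Proof. exact: blkdot_ge0. Qed.

Lemma blkdot_mean_dispersion (x : 'I_K -> R) :
  blkdot x x = dispersion x + INR K * (mean x * mean x).
Proof.
rewrite /dispersion /blkdot /centered.
rewrite (osum_ext _ (fun j => (x j - _) * _)
  (fun j => x j * x j - 2 * mean x * x j + mean x * mean x)); last by move=> j; ring.
by rewrite osum_add osum_sub osum_scal osum_const (osum_mean x); ring.
Qed.

Lemma dispersion_le (x : 'I_K -> R) : dispersion x <= blkdot x x.
Proof.
rewrite blkdot_mean_dispersion.
by have := INR_K_gt0; have := Rle_0_sqr (mean x); rewrite /Rsqr; nra.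
Qed.

Lemma mean_sq_le (x : 'I_K -> R) : INR K * (mean x * mean x) <= blkdot x x.
Proof. by rewrite blkdot_mean_dispersion; have := dispersion_ge0 x; lra. Qed.

Lemma mean_add (x y : 'I_K -> R) : mean (fun k => x k + y k) = mean x + mean y.
Proof. by rewrite /mean osum_add; lra. Qed.

Lemma dispersion_young (e : R) (x y : 'I_K -> R) : 0 < e ->
  dispersion (fun k => x k + y k) <= (1 + e) * dispersion x + (1 + / e) * dispersion y.
Proof.
by move=> e0; apply: blkdot_young => // k; rewrite /centered mean_add; ring.
Qed.

Variables (a : 'I_K -> 'I_K -> R) (lam : R).
Hypothesis Ha_sym : forall l k : 'I_K, a l k = a k l.
Hypothesis Ha_stoch : forall l : 'I_K, osum (fun k => a l k) = 1.
Hypothesis Hlam : second_largest_eig_mag a lam.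
Hypothesis Hlam01 : 0 < lam < 1.

(* The all-ones vector pairs to zero with every eigenvector but the dominant
   one, hence is a multiple of the latter; a vector with zero sum is therefore
   orthogonal to the dominant eigenvector. *)
Lemma combine_contract (x : 'I_K -> R) : osum x = 0 ->
  blkdot (combine a x) (combine a x) <= lam * lam * blkdot x x.
Proof.
move=> x0; case: Hlam => U [e [Uorth [aE [emono [p1 [p1E lamE]]]]]].
pose c p := osum (fun l => U l p).
pose b p := osum (fun l => x l * U l p).
have diag (f : 'I_K -> R) p :
    osum (fun l => U l p * osum (fun q => U l q * f q)) = f p.
  rewrite (osum_ext _ _ (fun l => osum (fun q => U l p * U l q * f q))); last first.
    by move=> l; rewrite -osum_scal; apply: osum_ext => q; ring.
  rewrite osum_exchange -[RHS](osum_delta _ p); apply: osum_ext => q.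
  rewrite osum_mul_r Uorth eq_sym; case: eqP => _; lra.
have one l : osum (fun q => U l q * (e q * c q)) = 1.
  rewrite -(Ha_stoch l) (osum_ext _ _ (fun q => osum (fun k => U l q * e q * U k q))); last first.
    by move=> q; rewrite osum_scal /c; ring.
  by rewrite osum_exchange; apply: osum_ext => k; rewrite aE.
have cE p : c p = e p * c p.
  rewrite -[RHS](diag (fun q => e q * c q)) /c; apply: osum_ext => l.
  by rewrite one; ring.
have small (p : 'I_K) : (1 <= p)%N -> Rabs (e p) <= lam.
  by rewrite lamE => p_ge1; apply: emono; rewrite p1E.
have c0 (p : 'I_K) : (1 <= p)%N -> c p = 0.
  move=> /small sp; have := cE p; have := Rle_abs (e p) => *.
  have : (1 - e p) * c p = 0 by nra.
  case/Rmult_integral; lra.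
pose p0 : 'I_K := Ordinal HK.
have not0 (p : 'I_K) : p != p0 -> (1 <= p)%N.
  by case: p => -[|p] ip //; rewrite -val_eqE.
have one0 l : U l p0 * (e p0 * c p0) = 1.
  rewrite -[RHS](one l) -[LHS](osum_delta _ p0 (fun q => U l q * (e q * c q))).
  apply: osum_ext => q; case: eqP => // /eqP /not0 /c0 ->; ring.
have b0 : b p0 = 0.
  have : (e p0 * c p0) * b p0 = 0.
    by rewrite -osum_scal -x0; apply: osum_ext => l; rewrite -[RHS]Rmult_1_r -(one0 l); ring.
  case/Rmult_integral => // z; have := one0 p0; rewrite z; lra.
have AE k : combine a x k = osum (fun q => U k q * (e q * b q)).
  rewrite (osum_ext _ _ (fun q => osum (fun l => U k q * e q * (x l * U l q)))); last first.
    by move=> q; rewrite osum_scal /b; ring.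
  rewrite osum_exchange; apply: osum_ext => l; rewrite aE -osum_mul_r.
  by apply: osum_ext => q; ring.
have AA : blkdot (combine a x) (combine a x) = osum (fun p => (e p * b p) * (e p * b p)).
  rewrite /blkdot (osum_ext _ _ (fun k => osum (fun p => (e p * b p) *
       (U k p * osum (fun q => U k q * (e q * b q)))))); last first.
    by move=> k; rewrite {1}AE -osum_mul_r; apply: osum_ext => p; rewrite AE; ring.
  by rewrite osum_exchange; apply: osum_ext => p; rewrite osum_scal diag.
(* [Uorth] is orthonormality of the columns of [U], so Bessel's inequality is directly available, by
   expanding the square norm of [x - U b]. *)
have bessel : osum (fun p => b p * b p) <= blkdot x x.
  pose y k := osum (fun q => U k q * b q).
  have yy : blkdot y y = osum (fun p => b p * b p).
    rewrite /blkdot (osum_ext _ _ (fun k => osum (fun p => b p * (U k p * y k)))); last first.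
      by move=> k; rewrite {1}/y -osum_mul_r; apply: osum_ext => p; ring.
    by rewrite osum_exchange; apply: osum_ext => p; rewrite osum_scal diag.
  have xy : blkdot x y = osum (fun p => b p * b p).
    rewrite /blkdot (osum_ext _ _ (fun k => osum (fun p => b p * (x k * U k p)))); last first.
      by move=> k; rewrite /y -osum_scal; apply: osum_ext => p; ring.
    by rewrite osum_exchange; apply: osum_ext => p; rewrite osum_scal.
  have := blkdot_ge0 _ (fun k => x k - y k).
  have -> : blkdot (fun k => x k - y k) (fun k => x k - y k)
     = blkdot x x - 2 * blkdot x y + blkdot y y.
    by rewrite /blkdot -osum_scal -osum_sub -osum_add; apply: osum_ext => k; ring.
  by rewrite xy yy; lra.
have l0 : 0 <= lam * lam by nra.
apply: Rle_trans (Rmult_le_compat_l _ _ _ l0 bessel).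
rewrite AA -osum_scal; apply: osum_le => p.
case: (eqVneq p p0) => [->|/not0 /small sp]; first by rewrite b0; lra.
have ee : e p * e p <= lam * lam.
  by have := Rsqr_abs (e p); rewrite /Rsqr => ->; have := Rabs_pos (e p); nra.
by have := Rle_0_sqr (b p); rewrite /Rsqr; nra.
Qed.

Lemma osum_combine (x : 'I_K -> R) : osum (combine a x) = osum x.
Proof.
rewrite /combine osum_exchange; apply: osum_ext => l.
by rewrite osum_mul_r Ha_stoch; ring.
Qed.

(** Symmetry makes [a] doubly stochastic, so combining commutes with centering and the contraction
    on zero-sum vectors applies. *)
Lemma dispersion_combine (x : 'I_K -> R) :
  dispersion (combine a x) <= lam * lam * dispersion x.
Proof.
apply: Rle_trans (combine_contract _ (osum_centered x)).
apply: Req_le; apply: osum_ext => k.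
suff -> : centered (combine a x) k = combine a (centered x) k by [].
rewrite /centered /mean osum_combine /combine.
rewrite (osum_ext _ (fun l => a l k * (x l - _))
  (fun l => a l k * x l - a k l * (osum x / INR K))); last by move=> l; rewrite (Ha_sym k); ring.
by rewrite osum_sub osum_mul_r Ha_stoch; ring.
Qed.

Lemma osum_iter_combine (J : nat) (x : 'I_K -> R) : osum (iter J (combine a) x) = osum x.
Proof. by elim: J => //= J IH; rewrite osum_combine. Qed.

(** One application supplies the factor; the others do not expand, as [lam * lam <= 1]. *)
Lemma dispersion_iter_combine (J : nat) (x : 'I_K -> R) : (1 <= J)%N ->
  dispersion (iter J (combine a) x) <= lam * lam * dispersion x.
Proof.
case: J => // J _; elim: J => [|J IH]; first exact: dispersion_combine.
rewrite iterS; apply: Rle_trans (dispersion_combine _) _.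
have d0 := dispersion_ge0 (iter J.+1 (combine a) x).
have l1 : lam * lam <= 1 by nra.
have := Rmult_le_compat_r _ _ _ d0 l1; lra.
Qed.

End Combination.

(** * Coupled delayed recursions *)

Lemma small_step (c b : R) : 0 < b ->
  exists2 m, 0 < m & forall mu, 0 < mu <= m -> mu * c <= b.
Proof.
move=> b0; have c0 := Rabs_pos c; have cc := Rle_abs c.
(* The denominator [Rabs c + 1] handles [c] of either sign as well as [c = 0]. *)
exists (b / (Rabs c + 1)); first by apply: Rdiv_lt_0_compat; lra.
move=> mu [mu0 mum].
apply: (Rle_trans _ (mu * (Rabs c + 1))); first by apply: Rmult_le_compat_l; lra.
have -> : b = b / (Rabs c + 1) * (Rabs c + 1) by field; lra.
by apply: Rmult_le_compat_r; lra.
Qed.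

Lemma small_step_both (P P' : R -> Prop) :
  (exists2 m, 0 < m & forall mu, 0 < mu <= m -> P mu) ->
  (exists2 m, 0 < m & forall mu, 0 < mu <= m -> P' mu) ->
  exists2 m, 0 < m & forall mu, 0 < mu <= m -> P mu /\ P' mu.
Proof.
move=> [m m0 mP] [m' m'0 mP']; exists (Rmin m m'); first exact: Rmin_pos.
move=> mu [mu0 mum]; have := Rmin_l m m'; have := Rmin_r m m' => *.
by split; [apply: mP | apply: mP']; lra.
Qed.

Lemma bernoulli (x : R) (n : nat) : 0 <= x <= 1 -> 1 - INR n * x <= (1 - x) ^ n.
Proof.
move=> x01; elim: n => [|n IH]; first by rewrite /=; lra.
have n0 := pos_INR n; rewrite S_INR /=.
have := Rmult_le_compat_l (1 - x) _ _ _ IH; nra.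
Qed.

Section Recursion.
Variables (J : nat) (nu n lam B cJ : R).
Hypotheses (HJ : (1 <= J)%N) (Hnu : 0 < nu) (Hn : 0 < n <= 1) (Hlam : 0 < lam < 1).
Hypotheses (HB : 0 <= B) (HcJ : 0 <= cJ).

(** Ratio of the dispersion bound to the staleness bound. It makes the forcing [B D] equal to a
    quarter of the margin [1 - lam] times the dispersion bound. *)
Definition consensus_ratio : R := 4 * B / (1 - lam).
Local Notation beta := consensus_ratio.

(** Bound on a squared move in units of [mu^2 b]: the six terms of [X_rec] add up to at most
    [4 (2 + beta) b] after the delay factor 2. *)
Definition move_ratio : R := 4 * B * (2 + beta).
Local Notation Bx := move_ratio.

Lemma consensus_ratio_ge0 : 0 <= beta.
Proof. by apply: Rmult_le_pos; [lra | apply/Rlt_le/Rinv_0_lt_compat; lra]. Qed.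

Lemma move_ratio_ge0 : 0 <= Bx.
Proof. by have := consensus_ratio_ge0; move=> ?; apply: Rmult_le_pos; lra. Qed.

(** In order: [mu <= 1]; the loss [mu nu / 5] fits in half of the contraction margin of [D], then of
    [C]; Bernoulli bounds for [rho^J] and [rho^(2J)]; the coupling terms fit in the slack of [W],
    then of [D]. As [J >= 1], the bound [2 / 5] also gives [mu nu <= 1]. The nested pairs match
    [small_step_both]. *)
Definition admissible (mu : R) : Prop :=
  ((mu * 1 <= 1 /\ mu * (nu / 5) <= n * n / 2) /\
   (mu * (nu / 5) <= n * (1 - lam) / 2 /\ mu * (INR J * (nu / 5)) <= (1 - lam) / 4)) /\
  ((mu * (INR (2 * J) * (nu / 5)) <= 2 / 5 /\
    mu * (2 * B * (beta + 1 + cJ * Bx) + Bx) <= 4 * nu / 5) /\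
   mu * (B * Bx * (1 + cJ)) <= n * n / 2).

Lemma small_step_admissible : exists2 m, 0 < m & forall mu, 0 < mu <= m -> admissible mu.
Proof.
have nn : 0 < n * n by nra.
have nl : 0 < n * (1 - lam) by apply: Rmult_lt_0_compat; lra.
by do !apply: small_step_both; apply: small_step; lra.
Qed.

Variable mu : R.
Hypotheses (mu_gt0 : 0 < mu) (mu_adm : admissible mu).
(** [X i] stands for the mean squared move at iteration [i], and [Y i] for the mean squared
    displacement between the entry of a sample into the pipeline and its exit at iteration [i]. [L]
    is the number of sampled indices over which the expectation runs, whence a finite horizon. *)
Variables (L : nat) (w0 : R) (W C D X Y : nat -> R).
Hypothesis w0_ge0 : 0 <= w0.
Hypothesis init : forall i, (i <= J)%N -> [/\ W i = w0, C i = 0 & D i = 0].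
Hypothesis X_init : forall i, (i < J)%N -> X i = 0.
Hypothesis X_rec : forall i, (J <= i)%N -> (i < L)%N ->
  let t := (i - J).+1 in
  X i <= mu * mu * (B * (W i + W t + C i + C t + D i + D t)).
Hypothesis Y_rec : forall i xb, (J <= i)%N -> (i < L)%N ->
  (forall s, (i < s + J)%N -> (s <= i)%N -> X s <= xb) -> Y i <= cJ * xb.
Hypothesis W_rec : forall i, (J <= i)%N -> (i < L)%N ->
  let t := (i - J).+1 in
  W i.+1 <= (1 - mu * nu) * W i + mu * (B * (C t + D t + Y i)) + X i.
Hypothesis D_rec : forall i, (J <= i)%N -> (i < L)%N ->
  D i.+1 <= (1 - n * n) * D i + B * (X i + Y i).
Hypothesis C_rec : forall i, (J <= i)%N -> (i < L)%N ->
  let t := (i - J).+1 in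
  C i.+1 <= (1 - n) * C i + n * (lam * C t + B * D t).

(** Strong induction on the three bounds together. The factor 2 in [b] absorbs the warm-up, where
    [W] stays at [w0] while [rho^i] already decays. *)
Lemma delayed_recursion_bounds i : (i <= L)%N ->
  let b := 2 * w0 * (1 - mu * nu / 5) ^ i in
  [/\ W i <= b, D i <= mu * b & C i <= mu * beta * b].
Proof.
have beta_ge0 := consensus_ratio_ge0; have Bx_ge0 := move_ratio_ge0.
pose rho := 1 - mu * nu / 5; pose bd s := 2 * w0 * rho ^ s; cbv zeta.
rewrite -/rho -/(bd i).
case: mu_adm => -[[a1 a2] [a3 a4]] [[a5 a6] a7].
have x0 : 0 < mu * (nu / 5) by apply: Rmult_lt_0_compat; lra.
have J1 : 1 <= INR J by apply: (le_INR 1); apply/leP.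
have x1 : mu * (nu / 5) <= 1 / 5 by rewrite mult_INR /= in a5; nra.
have rhoE : rho = 1 - mu * (nu / 5) by rewrite /rho; lra.
have rho0 : 0 < rho <= 1 by lra.
have xx : 0 <= mu * (nu / 5) <= 1 by lra.
have bern m := bernoulli _ m xx; rewrite -rhoE in bern.
have r2J : 1 / 2 <= rho ^ (2 * J) by have := bern (2 * J)%N; lra.
have rJ : 1 - (1 - lam) / 4 <= rho ^ J by have := bern J; lra.
have r2JJ : rho ^ (2 * J) <= rho ^ J.
  have p0 : 0 <= rho ^ J by apply: pow_le; lra.
  have p1 : rho ^ J <= 1 by rewrite -(pow1 J); apply: pow_incr; lra.
  by rewrite mul2n -addnn pow_add; nra.
have bd0 s : 0 <= bd s by apply: Rmult_le_pos; [lra | apply: pow_le; lra].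
have bdD s d : bd (s + d)%N = bd s * rho ^ d by rewrite /bd pow_add; ring.
have bd_mono s s' : (s <= s')%N -> bd s' <= bd s.
  move=> ss'; rewrite -(subnKC ss') bdD -[X in _ <= X]Rmult_1_r.
  apply: Rmult_le_compat_l => //; rewrite -(pow1 (s' - s)); apply: pow_incr; lra.
(* The only way in which the moves are charged for their delay: up to [2J] iterations back at the
   price of a factor 2. *)
have bd_delay s i' : (i' <= s + 2 * J)%N -> bd s <= 2 * bd i'.
  move=> si; apply: (Rle_trans _ (2 * bd (s + 2 * J)%N)).
    by rewrite bdD; have := Rmult_le_compat_l _ _ _ (bd0 s) r2J; lra.
  by have := bd_mono _ _ si; lra.
have mb0 : 0 <= mu * beta by apply: Rmult_le_pos; lra.
elim/ltn_ind: i => i IH iL.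
case: (leqP i J) => [iJ|].
  have [-> -> ->] := init i iJ.
  have wb : w0 <= bd i.
    apply: Rle_trans (bd_mono _ _ iJ); rewrite /bd.
    by have := Rmult_le_compat_l _ _ _ w0_ge0 (Rle_trans _ _ _ r2J r2JJ); lra.
  by split=> //; apply: Rmult_le_pos; lra.
case: i IH iL => // i IH iL; rewrite ltnS => Ji.
have iL' : (i < L)%N by [].
pose t := (i - J).+1.
have ti : (t <= i)%N by rewrite /t ltn_subrL HJ (leq_trans HJ Ji).
have tJ : (t + J)%N = i.+1 by rewrite /t addSn subnK.
have {}IH s : (s <= i)%N -> [/\ W s <= bd s, D s <= mu * bd s & C s <= mu * beta * bd s].
  by move=> si; apply: IH => //; apply: leq_trans si (ltnW iL).
pose b := bd i.+1; have b0 : 0 <= b := bd0 _.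
have bi : bd i * rho = b by rewrite /b -addn1 bdD /= Rmult_1_r.
have bt : bd t * rho ^ J = b by rewrite -bdD tJ.
have bt0 := bd0 t.
(* The window of moves entering [Y i]. Each refers to the state at [u = s - J + 1], which is less
   than [2J] iterations before [i+1]. *)
have Xle s : (i < s + J)%N -> (s <= i)%N -> X s <= mu * mu * Bx * b.
  move=> is_ si; case: (ltnP s J) => [/X_init ->|Js].
    by do !apply: Rmult_le_pos => //; lra.
  apply: Rle_trans (X_rec s Js (leq_ltn_trans si iL')) _ => /=.
  rewrite (Rmult_assoc _ Bx); apply: Rmult_le_compat_l; first nra.
  rewrite /move_ratio (_ : _ * b = B * (4 * (2 + beta) * b)); last ring.
  apply: Rmult_le_compat_l => //.
  set u := (s - J).+1.
  have us : (u <= s)%N by rewrite /u ltn_subrL HJ (leq_trans HJ Js).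
  have uJ : (u + J)%N = s.+1 by rewrite /u addSn subnK.
  have bu : bd u <= 2 * b.
    apply: bd_delay; rewrite mul2n -addnn addnA uJ addSn.
    by rewrite ltnS ltnW.
  have bs : bd s <= 2 * b := Rle_trans _ _ _ (bd_mono _ _ us) bu.
  have [w1 d1 c1] := IH s si; have [w2 d2 c2] := IH u (leq_trans us si).
  have [u0 s0] := (bd0 u, bd0 s).
  have : mu * bd s <= 2 * b by nra.
  have : mu * bd u <= 2 * b by nra.
  have : mu * beta * bd s <= beta * (2 * b).
    rewrite (Rmult_comm mu) Rmult_assoc; apply: Rmult_le_compat_l => //; nra.
  have : mu * beta * bd u <= beta * (2 * b).
    rewrite (Rmult_comm mu) Rmult_assoc; apply: Rmult_le_compat_l => //; nra.
  lra.
have Xi : X i <= mu * mu * Bx * b.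
  by apply: Xle => //; rewrite -addn1 leq_add2l.
have Yi := Y_rec i _ Ji iL' Xle.
have [Wi Di Ci] := IH i (leqnn i); have [Wt Dt Ct] := IH t ti.
have bt2 : bd t <= 2 * b by apply: bd_delay; rewrite -tJ leq_add2l leq_pmull.
have mB0 : 0 <= mu * B by apply: Rmult_le_pos; lra.
have mmb0 : 0 <= mu * mu * b by apply: Rmult_le_pos => //; nra.
have mm : mu * mu <= mu by nra.
have bi0 := bd0 i.
rewrite -/b; split.
- apply: Rle_trans (W_rec i Ji iL') _ => /=; rewrite -/t.
  (* Dividing by [rho] costs a fifth of [mu nu], since [(1 - 4y/5)(1 - y/5) >= 1 - y]; the remaining
     four fifths pay for the coupling. *)
  have e1 : (1 - mu * nu) * W i <= (1 - 4 / 5 * (mu * nu)) * b.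
    apply: (Rle_trans _ ((1 - mu * nu) * bd i)); first by apply: Rmult_le_compat_l; lra.
    rewrite -bi (_ : (1 - 4 / 5 * _) * _ = (1 - 4 / 5 * (mu * nu)) * rho * bd i); last ring.
    by apply: Rmult_le_compat_r => //; rewrite rhoE; nra.
  have k0 : 0 <= cJ * Bx * b := Rmult_le_pos _ _ (Rmult_le_pos _ _ HcJ Bx_ge0) b0.
  have e2 : C t + D t + Y i <= mu * b * (2 * (beta + 1 + cJ * Bx)).
    have : mu * beta * bd t <= mu * beta * (2 * b) by apply: Rmult_le_compat_l.
    have : mu * bd t <= mu * (2 * b) by apply: Rmult_le_compat_l => //; lra.
    have : cJ * Bx * b * (mu * mu) <= cJ * Bx * b * mu.
      exact: Rmult_le_compat_l.
    have : 0 <= cJ * Bx * b * mu by apply: Rmult_le_pos => //; lra.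
    lra.
  have e3 := Rmult_le_compat_l _ _ _ mB0 e2.
  have e4 : mu * b * (mu * (2 * B * (beta + 1 + cJ * Bx) + Bx)) <= mu * b * (4 * nu / 5).
    by apply: Rmult_le_compat_l => //; apply: Rmult_le_pos; lra.
  lra.
- apply: Rle_trans (D_rec i Ji iL') _.
  have nn : n * n <= 1 by nra.
  have e1 : (1 - n * n) * D i <= (1 - n * n / 2) * (mu * b).
    apply: (Rle_trans _ ((1 - n * n) * (mu * bd i))); first by apply: Rmult_le_compat_l; lra.
    rewrite -bi (_ : (1 - n * n / 2) * _ = (1 - n * n / 2) * rho * (mu * bd i)); last ring.
    apply: Rmult_le_compat_r; first by apply: Rmult_le_pos; lra.
    by rewrite rhoE; nra.
  have e2 : B * (X i + Y i) <= B * ((1 + cJ) * (mu * mu * Bx * b)).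
    by apply: Rmult_le_compat_l => //; lra.
  have e3 : mu * b * (mu * (B * Bx * (1 + cJ))) <= mu * b * (n * n / 2).
    by apply: Rmult_le_compat_l => //; apply: Rmult_le_pos; lra.
  lra.
- apply: Rle_trans (C_rec i Ji iL') _ => /=; rewrite -/t.
  have e1 : (1 - n) * C i <= (1 - n + n * (1 - lam) / 2) * (mu * beta * b).
    apply: (Rle_trans _ ((1 - n) * (mu * beta * bd i))); first by apply: Rmult_le_compat_l; lra.
    rewrite -bi (_ : (1 - n + _) * _ = (1 - n + n * (1 - lam) / 2) * rho * (mu * beta * bd i)); last ring.
    apply: Rmult_le_compat_r; first exact: Rmult_le_pos.
    have sn : n * (1 - lam) / 2 <= n by nra.
    rewrite rhoE; move: (n * (1 - lam) / 2) (mu * (nu / 5)) x0 a3 sn => s x x0 xs sn; nra.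
  have BE : B = beta * (1 - lam) / 4 by rewrite /consensus_ratio; field; lra.
  have e2 : lam * C t + B * D t <= (1 + 3 * lam) / 4 * (mu * beta * bd t).
    have := Rmult_le_compat_l _ _ _ (Rlt_le _ _ (proj1 Hlam)) Ct.
    have := Rmult_le_compat_l _ _ _ HB Dt; rewrite {2}BE; lra.
  (* With [rho^J >= 1 - (1 - lam) / 4] this reduces to [(1 - lam)^2 >= 0]. *)
  have e3 : (1 + 3 * lam) / 4 * (mu * beta * bd t) <= (1 + lam) / 2 * (mu * beta * b).
    rewrite -bt (_ : (1 + lam) / 2 * _ = (1 + lam) / 2 * rho ^ J * (mu * beta * bd t)); last ring.
    by apply: Rmult_le_compat_r; [exact: Rmult_le_pos | nra].
  have := Rmult_le_compat_l n _ _ _ (Rle_trans _ _ _ e2 e3); lra.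
Qed.
End Recursion.

(** * Expectation over the sampled indices *)

Section Expectation.
Variable N : nat.
Hypothesis HN : (0 < N)%N.
Implicit Types (f g : seq 'I_N -> R).

Lemma sum_lists_ext L f g : (forall s, f s = g s) -> sum_lists L f = sum_lists L g.
Proof. by elim: L f g => //= L IH f g fg; apply: osum_ext => n; apply: IH. Qed.

Lemma sum_lists_le L f g : (forall s, f s <= g s) -> sum_lists L f <= sum_lists L g.
Proof. by elim: L f g => //= L IH f g fg; apply: osum_le => n; apply: IH. Qed.

Lemma sum_lists_add L f g :
  sum_lists L (fun s => f s + g s) = sum_lists L f + sum_lists L g.
Proof.
by elim: L f g => //= L IH f g; rewrite -osum_add; apply: osum_ext => n; rewrite IH.
Qed.

Lemma sum_lists_scal L c f : sum_lists L (fun s => c * f s) = c * sum_lists L f.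
Proof.
by elim: L f => //= L IH f; rewrite -osum_scal; apply: osum_ext => n; rewrite IH.
Qed.

Lemma sum_lists_const L c : sum_lists L (fun _ : seq 'I_N => c) = INR N ^ L * c.
Proof.
elim: L => [|L IH] /=; first ring.
by rewrite (osum_ext _ _ (fun=> INR N ^ L * c)) // osum_const; ring.
Qed.

Lemma sum_lists_osum L m (F : 'I_m -> seq 'I_N -> R) :
  sum_lists L (fun s => osum (fun i => F i s)) = osum (fun i => sum_lists L (F i)).
Proof.
elim: L F => //= L IH F; rewrite osum_exchange.
by apply: osum_ext => n; rewrite (IH (fun i s => F i (n :: s))).
Qed.

(** At [j = 0] the inner average no longer depends on the head of the list, so the outer sum over
    the head yields a factor [N] that cancels [/ INR N]. *)
Lemma sum_lists_resample d0 L j f : (j < L)%N ->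
  sum_lists L f =
  sum_lists L (fun s => / INR N * osum (fun m => f (set_nth d0 s j m))).
Proof.
elim: L j f => // L IH [|j] f jL /=; last first.
  by apply: osum_ext => n; exact: (IH j (fun s => f (n :: s))).
rewrite osum_const sum_lists_scal sum_lists_osum.
have N0 : 0 < INR N by apply: lt_0_INR; apply/ltP.
by rewrite -Rmult_assoc Rinv_r ?Rmult_1_l //; lra.
Qed.

Variables (d0 : 'I_N) (L : nat).
Local Notation E := (expect_first d0 L).
Implicit Types (F G : (nat -> 'I_N) -> R).

Lemma INR_pow_gt0 : 0 < INR N ^ L.
Proof. by apply: pow_lt; apply: lt_0_INR; apply/ltP. Qed.

Lemma expect_le F G : (forall ns, F ns <= G ns) -> E F <= E G.
Proof.
move=> FG; apply: Rmult_le_compat_r; first exact/Rlt_le/Rinv_0_lt_compat/INR_pow_gt0.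
exact: sum_lists_le.
Qed.

Lemma expect_ext F G : (forall ns, F ns = G ns) -> E F = E G.
Proof. by move=> FG; rewrite /expect_first (sum_lists_ext L _ _ (fun s => FG _)). Qed.

Lemma expect_add F G : E (fun ns => F ns + G ns) = E F + E G.
Proof. by rewrite /expect_first sum_lists_add /Rdiv; ring. Qed.

Lemma expect_scal c F : E (fun ns => c * F ns) = c * E F.
Proof. by rewrite /expect_first sum_lists_scal /Rdiv; ring. Qed.

Lemma expect_const c : E (fun _ => c) = c.
Proof. by rewrite /expect_first sum_lists_const; have := INR_pow_gt0 => ?; field; lra. Qed.

(** Predecessors are compared because [expect_first] reads the list at [t.-1], so that times 0 and 1
    share one entry. *)
Definition resample (ns : nat -> 'I_N) (j : nat) (m : 'I_N) : nat -> 'I_N :=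
  fun t => if t.-1 == j.-1 then m else ns t.

Lemma expect_resample j F : (0 < j <= L)%N ->
  E F = E (fun ns => / INR N * osum (fun m => F (resample ns j m))).
Proof.
case/andP=> j0 jL; rewrite /expect_first (sum_lists_resample d0 L j.-1) ?prednK //.
congr (_ / _); apply: sum_lists_ext => s; congr (_ * _); apply: osum_ext => m.
by congr F; apply: functional_extensionality => t; rewrite nth_set_nth.
Qed.

End Expectation.

(** * Derivatives at a minimum and averaged inner products *)

Lemma derivable_pt_lim_min (f : R -> R) (l : R) :
  (forall s, f 0 <= f s) -> derivable_pt_lim f 0 l -> l = 0.
Proof.
move=> fmin fl.
rewrite -(derive_pt_eq_0 f 0 l (exist _ l fl) fl).
by apply: (deriv_minimum f (-1) 1) => *; [lra | lra | exact: fmin].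
Qed.

Lemma derivable_pt_lim_osum m (f : 'I_m -> R -> R) (l : 'I_m -> R) (x : R) :
  (forall i, derivable_pt_lim (f i) x (l i)) ->
  derivable_pt_lim (fun s => osum (fun i => f i s)) x (osum l).
Proof.
move=> fl; rewrite /osum; elim: (enum _) => [|i s IH] /=.
  exact: (derivable_pt_lim_const 0 x).
exact: (derivable_pt_lim_plus (f i) _ x (l i)).
Qed.

Lemma vdot_wsum_avg N K (M : 'I_K -> nat) (c : R) (x : Vec M) (y : 'I_N -> Vec M) :
  c * osum (fun n => vdot x (y n)) = vdot x (fun k j => c * osum (fun n => y n k j)).
Proof.
rewrite /vdot osum_exchange -osum_scal; apply: osum_ext => k.
rewrite /blkdot osum_exchange -osum_scal; apply: osum_ext => j.
by rewrite osum_scal; ring.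
Qed.

(** * Gradients and one iteration of the algorithm *)

Section Algorithm.
Variables (N K : nat) (M : 'I_K -> nat).
Hypothesis HN : (0 < N)%N.
Variables (h : 'I_N -> Vec M) (gamma : 'I_N -> R) (Q dQ : R -> R -> R).
Variable r : forall k : 'I_K, ('I_(M k) -> R) -> R.
Variable grad_r : forall k : 'I_K, ('I_(M k) -> R) -> 'I_(M k) -> R.
Variables (delta eta nu : R) (wstar : Vec M).
Hypothesis HdQ : forall (n : 'I_N) (z : R),
  derivable_pt_lim (fun z' => Q z' (gamma n)) z (dQ z (gamma n)).
Hypothesis Hdelta : 0 < delta.
Hypothesis Hdelta_Q : forall (n : 'I_N) (z1 z2 : R),
  Rabs (dQ z1 (gamma n) - dQ z2 (gamma n)) <= delta * Rabs (z1 - z2).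
Hypothesis Hr_grad : forall (k : 'I_K) (x d : 'I_(M k) -> R),
  derivable_pt_lim (fun s => r k (fun j => x j + s * d j)) 0 (blkdot (grad_r k x) d).
Hypothesis Heta : 0 < eta.
Hypothesis Hr_Lip : forall x y : Vec M,
  vnorm (vsub (grad_rsum grad_r x) (grad_rsum grad_r y)) <= eta * vnorm (vsub x y).
Hypothesis Hmin : forall w : Vec M, risk h gamma Q r wstar <= risk h gamma Q r w.

Local Notation gR := (grad_risk h gamma dQ grad_r).

Lemma INR_N_ge1 : 1 <= INR N.
Proof. by apply: (le_INR 1); apply/leP. Qed.

Lemma INR_Ninv : 0 < / INR N <= 1.
Proof.
have N1 := INR_N_ge1; split; first by apply: Rinv_0_lt_compat; lra.
by rewrite -[X in _ <= X]Rinv_1; apply: Rinv_le_contravar; lra.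
Qed.

(** Along the line through [wstar] in the direction of the gradient itself, the derivative of the
    risk at 0 is the squared norm of that gradient, and it vanishes at a minimum. *)
Lemma grad_risk_min k j : gR wstar k j = 0.
Proof.
pose d := gR wstar.
suff : vdot d d = 0.
  move=> dd0; have := osum_eq0 _ _ (fun k => blkdot_ge0 _ (d k)) dd0 k.
  move/(osum_eq0 _ _ (fun j => Rle_0_sqr (d k j)))=> /(_ j).
  by case/Rmult_integral.
apply: (derivable_pt_lim_min (fun s => risk h gamma Q r (vadd wstar (vscale s d)))).
  move=> s; rewrite (_ : vadd wstar (vscale 0 d) = wstar) //.
  apply: functional_extensionality_dep => k'; apply: functional_extensionality => j'.
  by rewrite /vadd /vscale; ring.
have -> : vdot d d =
    / INR N * osum (fun n => dQ (vdot (h n) wstar) (gamma n) * vdot (h n) d)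
    + osum (fun k' => blkdot (grad_r k' (wstar k')) (d k')).
  rewrite (osum_ext _ _ (fun n => vdot d (gradQn h gamma dQ n wstar))); last first.
    by move=> n; rewrite vdotZ (vdotC _ _ d).
  rewrite vdot_wsum_avg /vdot -osum_add; apply: osum_ext => k'.
  rewrite /blkdot -osum_add; apply: osum_ext => j'.
  by rewrite {1}/d /grad_risk; ring.
apply: (derivable_pt_lim_plus
  (fun s => / INR N * osum (fun n => Q (vdot (h n) (vadd wstar (vscale s d))) (gamma n)))
  (fun s => rsum r (vadd wstar (vscale s d)))).
  apply: (derivable_pt_lim_scal
    (fun s => osum (fun n => Q (vdot (h n) (vadd wstar (vscale s d))) (gamma n)))).
  apply: derivable_pt_lim_osum => n.
  have lin s : vdot (h n) (vadd wstar (vscale s d)) = vdot (h n) wstar + s * vdot (h n) d.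
    by rewrite vdotD vdotZ.
  rewrite (_ : (fun s => _) =
      comp (fun z => Q z (gamma n)) (fun s => vdot (h n) wstar + s * vdot (h n) d)); last first.
    by apply: functional_extensionality => s; rewrite lin.
  apply: derivable_pt_lim_comp; last first.
    by rewrite (_ : _ + 0 * _ = vdot (h n) wstar); [exact: HdQ | ring].
  rewrite -[X in derivable_pt_lim _ _ X]Rplus_0_l; apply: derivable_pt_lim_plus.
    exact: (derivable_pt_lim_const _ 0).
  rewrite -[X in derivable_pt_lim _ _ X]Rmult_1_r.
  rewrite (_ : (fun s => s * _) = mult_real_fct (vdot (h n) d) id); last first.
    by apply: functional_extensionality => s; rewrite /mult_real_fct Rmult_comm.
  exact/derivable_pt_lim_scal/derivable_pt_lim_id.
apply: derivable_pt_lim_osum => k'; exact: Hr_grad.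
Qed.

(** A crude constant dominating all data norms at once. *)
Definition feature_energy : R := osum (fun n => vdot (h n) (h n)).
Local Notation Hs := feature_energy.

Lemma feature_energy_ge0 : 0 <= Hs.
Proof. by apply: osum_ge0 => n; exact: vdot_ge0. Qed.

Lemma feature_energy_blk n k : blkdot (h n k) (h n k) <= Hs.
Proof.
apply: (Rle_trans _ (vdot (h n) (h n))).
  by apply: (osum_term_le _ (fun k => blkdot (h n k) (h n k))) => i; exact: blkdot_ge0.
by apply: (osum_term_le _ (fun n => vdot (h n) (h n))) => i; exact: vdot_ge0.
Qed.

(** A table is a block vector with one block of size [K] per sample, so [vdot] and [sqdist] serve
    for tables too. *)
Local Notation tab := (@Vec N (fun _ => K)).

Definition feature_comb (b : tab) : Vec M := fun k j => osum (fun n => b n k * h n k j).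

(** Cauchy-Schwarz over the samples, one coordinate [(k, j)] at a time. *)
Lemma feature_comb_le (b : tab) :
  vdot (feature_comb b) (feature_comb b) <= Hs * vdot b b.
Proof.
rewrite /vdot /blkdot (osum_exchange N K) -osum_scal; apply: osum_le => k.
apply: (Rle_trans _ (osum (fun j => osum (fun n => b n k * b n k)
                                * osum (fun n => h n k j * h n k j)))).
  by apply: osum_le => j; exact: (blkdot_CS _ (fun n => b n k) (fun n => h n k j)).
rewrite osum_scal Rmult_comm; apply: Rmult_le_compat_r.
  by apply: osum_ge0 => n; exact: Rle_0_sqr.
rewrite osum_exchange; apply: osum_le => n.
by apply: (osum_term_le _ (fun k => blkdot (h n k) (h n k))) => i; exact: blkdot_ge0.
Qed.

Lemma feature_row_le (m : 'I_N) (b : 'I_K -> R) (x : Vec M) :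
  (forall k j, x k j = b k * h m k j) -> vdot x x <= Hs * blkdot b b.
Proof.
move=> xE; rewrite /vdot {2}/blkdot -osum_scal; apply: osum_le => k.
have -> : blkdot (x k) (x k) = b k * b k * blkdot (h m k) (h m k).
  by rewrite /blkdot -osum_scal; apply: osum_ext => j; rewrite xE; ring.
by rewrite Rmult_comm; apply: Rmult_le_compat_r;
  [exact: Rle_0_sqr | exact: feature_energy_blk].
Qed.

Lemma dQ_sq_le (n : 'I_N) (z1 z2 : R) :
  (dQ z1 (gamma n) - dQ z2 (gamma n)) * (dQ z1 (gamma n) - dQ z2 (gamma n))
  <= delta * delta * ((z1 - z2) * (z1 - z2)).
Proof.
have [e1 e2] := (Rsqr_abs (dQ z1 (gamma n) - dQ z2 (gamma n)), Rsqr_abs (z1 - z2)).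
rewrite /Rsqr in e1 e2; rewrite e1 e2.
have d := Hdelta_Q n z1 z2.
have := Rmult_le_compat _ _ _ _ (Rabs_pos _) (Rabs_pos _) d d; lra.
Qed.

Definition outputs (w : Vec M) : tab := fun n _ => vdot (h n) w.
Definition records (w : Vec M) : tab := fun n k => INR K * blkdot (h n k) (w k).

Lemma osum_records (w : Vec M) n : osum (records w n) = INR K * vdot (h n) w.
Proof. by rewrite /records osum_scal. Qed.

Definition record_const : R := INR N * (INR K * INR K * Hs).
Local Notation cq := record_const.

Lemma record_const_ge0 : 0 <= cq.
Proof.
have := feature_energy_ge0; have := INR_N_ge1; have := Rle_0_sqr (INR K).
rewrite /record_const /Rsqr => *; apply: Rmult_le_pos; first lra.
exact: Rmult_le_pos.
Qed.

Lemma records_lip (w w' : Vec M) :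
  sqdist (records w) (records w') <= cq * sqdist w w'.
Proof.
rewrite /record_const Rmult_assoc -osum_const /sqdist; apply: osum_le => n.
rewrite /vdot {1}/blkdot -osum_scal; apply: osum_le => k; rewrite /vsub -/(vsub w w' k).
have -> : records w n k - records w' n k = INR K * blkdot (h n k) (vsub w w' k).
  rewrite /records /blkdot /vsub -!osum_scal -osum_sub.
  by apply: osum_ext => j; ring.
have CS := blkdot_CS _ (h n k) (vsub w w' k).
have := Rmult_le_compat_r _ _ _ (blkdot_ge0 _ (vsub w w' k)) (feature_energy_blk n k).
move/(Rle_trans _ _ _ CS)/(Rmult_le_compat_l _ _ _ (Rle_0_sqr (INR K))).
rewrite /Rsqr; lra.
Qed.

(** Outputs are agent averages of records, and averaging does not increase the norm. *)
Lemma outputs_lip (HK : (0 < K)%N) (w w' : Vec M) :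
  sqdist (outputs w) (outputs w') <= cq * sqdist w w'.
Proof.
apply: Rle_trans (records_lip w w'); apply: osum_le => n.
apply: Rle_trans (mean_sq_le _ HK _); rewrite /blkdot /vsub /outputs osum_const; apply: Req_le.
suff -> : mean (fun k => records w n k - records w' n k) = vdot (h n) w - vdot (h n) w' by [].
have K0 := INR_K_gt0 _ HK.
by rewrite /mean osum_sub !osum_records; field; lra.
Qed.

(** Splits a gradient built from any table [b] of derivatives into the true gradient and the error
    of the table. *)
Lemma grad_risk_diff_feature (w : Vec M) (b : tab) k j :
  / INR N * feature_comb b k j + grad_r k (w k) j
  = gR w k j + / INR N * feature_comb (fun n k => b n k - dQ (outputs w n k) (gamma n)) k j.
Proof.
rewrite /grad_risk /feature_comb /gradQn /vscale /outputs.
rewrite (osum_ext _ (fun n => (b n k - _) * _) (fun n => b n k * h n k j -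
  dQ (vdot (h n) w) (gamma n) * h n k j)); last by move=> n; ring.
by rewrite osum_sub; ring.
Qed.

Lemma vdot_scale_inv_le (x : Vec M) :
  vdot (vscale (/ INR N) x) (vscale (/ INR N) x) <= vdot x x.
Proof.
rewrite -[X in _ <= X]Rmult_1_l; apply: vdot_le => k j; rewrite /vscale.
have [c0 c1] := INR_Ninv.
have cc : / INR N * / INR N <= 1 by nra.
have := Rmult_le_compat_r _ _ _ (Rle_0_sqr (x k j)) cc; rewrite /Rsqr; lra.
Qed.

Lemma feature_comb_dQ_le (b b' : tab) :
  let f : tab := fun n k => dQ (b n k) (gamma n) - dQ (b' n k) (gamma n) in
  vdot (vscale (/ INR N) (feature_comb f)) (vscale (/ INR N) (feature_comb f))
  <= Hs * (delta * delta) * sqdist b b'.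
Proof.
move=> f; apply: Rle_trans (vdot_scale_inv_le _) _; apply: Rle_trans (feature_comb_le _) _.
rewrite Rmult_assoc; apply: Rmult_le_compat_l; first exact: feature_energy_ge0.
by apply: vdot_le => n k; exact: dQ_sq_le.
Qed.

Lemma vnorm_le_sq (x y : Vec M) (c : R) : 0 <= c -> vnorm x <= c * vnorm y ->
  vdot x x <= c * c * vdot y y.
Proof.
move=> c0; rewrite /vnorm => xy.
have [x0 y0] := (vdot_ge0 _ _ x, vdot_ge0 _ _ y).
have := Rmult_le_compat _ _ _ _ (sqrt_pos _) (sqrt_pos _) xy xy.
have := sqrt_sqrt _ x0; have := sqrt_sqrt _ y0.
by move: (sqrt _) (sqrt _) => u v <- <-; lra.
Qed.

(** The gradient is Lipschitz and vanishes at [wstar]. *)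
Lemma grad_risk_sq_le (HK : (0 < K)%N) : exists2 B, 0 <= B &
  forall w : Vec M, vdot (gR w) (gR w) <= B * sqdist w wstar.
Proof.
have H0 := feature_energy_ge0; have q0 := record_const_ge0.
have c0 : 0 <= Hs * (delta * delta) by apply: Rmult_le_pos => //; nra.
exists (2 * (Hs * (delta * delta) * cq) + 2 * (eta * eta)).
  have := Rmult_le_pos _ _ c0 q0; nra.
move=> w.
pose x : Vec M := vscale (/ INR N) (feature_comb (fun n k =>
   dQ (outputs w n k) (gamma n) - dQ (outputs wstar n k) (gamma n))).
pose y : Vec M := vsub (grad_rsum grad_r w) (grad_rsum grad_r wstar).
apply: (Rle_trans _ (2 * vdot x x + 2 * vdot y y)).
  apply: vdot_split2 => k j.
  have := grad_risk_diff_feature wstar (fun n k => dQ (outputs w n k) (gamma n)) k j.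
  rewrite grad_risk_min /x /y /vscale /vsub /grad_rsum.
  rewrite /grad_risk /gradQn /feature_comb /vscale /outputs; lra.
have xx : vdot x x <= _ := feature_comb_dQ_le (outputs w) (outputs wstar).
have yy : vdot y y <= _ * sqdist _ _ := vnorm_le_sq _ _ eta (Rlt_le _ _ Heta) (Hr_Lip w wstar).
have oo := Rmult_le_compat_l _ _ _ c0 (outputs_lip HK w wstar).
lra.
Qed.

(** * One-step inequalities for distance, dispersion and staleness *)

Hypothesis HK : (0 < K)%N.
Hypothesis Hnu : 0 < nu.
Hypothesis Hstrong : forall w1 w2 : Vec M,
  vdot (vsub (gR w1) (gR w2)) (vsub w1 w2) >= nu * vdot (vsub w1 w2) (vsub w1 w2).
Variables (a : 'I_K -> 'I_K -> R) (lam : R) (J : nat).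
Hypothesis Ha_sym : forall l k : 'I_K, a l k = a k l.
Hypothesis Ha_stoch : forall l : 'I_K, osum (fun k => a l k) = 1.
Hypothesis Hlam : second_largest_eig_mag a lam.
Hypothesis Hlam01 : 0 < lam < 1.
Hypothesis HJ : (1 <= J)%N.

Implicit Types S T : St N K M.

(* [T] is the state when the sample entered the pipeline, [S] the state when
   it leaves it. *)
Definition exit_tab T : tab := fun n =>
  iter J (combine a) (fun k => su T n k + records (sw T) n k - sv T n k).

Definition direction S T (m : 'I_N) : Vec M := fun k j =>
  (dQ (exit_tab T m k) (gamma m) - dQ (su S m k) (gamma m)) * h m k j
  + / INR N * osum (fun n => dQ (su S n k) (gamma n) * h n k j)
  + grad_r k (sw S k) j.

Definition next (mu : R) S T (m : 'I_N) : St N K M := mkSt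
  (fun k j => sw S k j - mu * direction S T m k j)
  (fun n k => if n == m then exit_tab T m k else su S n k)
  (fun n k => if n == m then records (sw T) m k else sv S n k).

Definition balanced S : Prop := forall n, osum (su S n) = osum (sv S n).
Definition consensus S : R := osum (fun n => dispersion (su S n)).
Definition drift S : R := sqdist (sv S : tab) (records (sw S)).

Lemma consensus_ge0 S : 0 <= consensus S.
Proof. by apply: osum_ge0 => n; exact: dispersion_ge0. Qed.

Lemma drift_ge0 S : 0 <= drift S.
Proof. exact: sqdist_ge0. Qed.

(** The sums of [su] and [sv] cancel in the pipeline input, and combination preserves sums. *)
Lemma osum_exit T n : balanced T -> osum (exit_tab T n) = osum (records (sw T) n).
Proof.
by move=> bT; rewrite (osum_iter_combine _ _ Ha_stoch) osum_sub osum_add bT; lra.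
Qed.

Lemma next_balanced mu S T m : balanced S -> balanced T -> balanced (next mu S T m).
Proof.
move=> bS bT n; rewrite /next /=; case: eqP => [_|_]; last exact: bS.
exact: osum_exit.
Qed.

(** Young's inequality with weight [e = / lam - 1] has [lam^2 (1 + e) = lam]; this is the other
    coefficient [lam^2 (1 + 1/e)]. *)
Definition track_const : R := lam * lam / (1 - lam).
Local Notation c4 := track_const.

Lemma track_const_ge0 : 0 <= c4.
Proof.
by apply: Rmult_le_pos; [nra | apply/Rlt_le/Rinv_0_lt_compat; lra].
Qed.

Lemma exit_dispersion T n : dispersion (exit_tab T n) <=
  lam * dispersion (su T n)
  + c4 * blkdot (vsub (sv T : tab) (records (sw T)) n) (vsub (sv T : tab) (records (sw T)) n).
Proof.
apply: Rle_trans (dispersion_iter_combine _ HK _ _ Ha_sym Ha_stoch Hlam Hlam01 _ _ HJ) _.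
have e0 : 0 < / lam - 1.
  suff : 1 < / lam by lra.
  by rewrite -{1}Rinv_1; apply: Rinv_lt_contravar; lra.
have := dispersion_young _ _ (su T n) (fun k => records (sw T) n k - sv T n k) e0.
set x := (fun k => su T n k + _ - _); rewrite (_ : (fun k => _ + (_ - _)) = x); last first.
  by apply: functional_extensionality => k; rewrite /x; ring.
have := dispersion_le _ HK (fun k => records (sw T) n k - sv T n k).
rewrite [X in _ <= X](_ : _ =
  blkdot (vsub (sv T : tab) (records (sw T)) n) (vsub (sv T : tab) (records (sw T)) n)); last first.
  by apply: osum_ext => k; rewrite /vsub; ring.
move: (blkdot _ _) (dispersion x) (dispersion (su T n)) (dispersion _) => p t s q qp ts.
have l2 : 0 <= lam * lam by nra.
apply: Rle_trans (Rmult_le_compat_l _ _ _ l2 ts) _.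
rewrite (_ : lam * lam * _ = lam * s + c4 * q); last by rewrite /track_const; field; lra.
by have := Rmult_le_compat_l _ _ _ track_const_ge0 qp; lra.
Qed.

(** The mean of an exit row is exactly [h_n^T w], the factor [K] of the records cancelling the
    averaging, so the error is pure dispersion. *)
Lemma exit_err T : balanced T ->
  sqdist (exit_tab T) (outputs (sw T)) <= lam * consensus T + c4 * drift T.
Proof.
move=> bT; rewrite /consensus /drift /sqdist /vdot -!osum_scal -osum_add.
apply: osum_le => n; apply: Rle_trans (exit_dispersion T n); apply: Req_le.
suff mE : mean (exit_tab T n) = vdot (h n) (sw T).
  by apply: osum_ext => k; rewrite /centered mE.
have K0 := INR_K_gt0 _ HK.
by rewrite /mean osum_exit // osum_records; field; lra.
Qed.

(** Splits off the mean: the centered part of [su] is the dispersion, and by balance its mean is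
    that of [sv], hence controlled by the drift. *)
Lemma table_err S : balanced S ->
  sqdist (su S : tab) (outputs (sw S)) <= consensus S + drift S.
Proof.
move=> bS; rewrite /consensus /drift /sqdist /vdot -osum_add.
apply: osum_le => n; rewrite (blkdot_mean_dispersion _ HK); apply: Rplus_le_compat.
  apply/Req_le/osum_ext => k.
  rewrite /centered /mean /vsub /outputs osum_sub osum_const.
  by have K0 := INR_K_gt0 _ HK; field; lra.
apply: Rle_trans (mean_sq_le _ HK _); apply: Req_le.
suff -> : mean (vsub (su S : tab) (outputs (sw S)) n) =
          mean (vsub (sv S : tab) (records (sw S)) n) by [].
by rewrite /mean /vsub /outputs !osum_sub bS osum_records osum_const.
Qed.

Lemma exit_err_now : exists2 B, 0 <= B & forall S T, balanced T ->
  sqdist (exit_tab T) (outputs (sw S))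
  <= B * (consensus T + drift T + sqdist (sw S) (sw T)).
Proof.
have [q0 c0] := (record_const_ge0, track_const_ge0).
exists (2 * (1 + c4 + cq)); first lra.
move=> S T bT; have tri := sqdist_triangle _ _ (outputs (sw T)) (exit_tab T) (outputs (sw S)).
have := outputs_lip HK (sw T) (sw S); rewrite (sqdistC _ _ (sw T)).
have := exit_err T bT; have := consensus_ge0 T; have := drift_ge0 T.
have := sqdist_ge0 _ _ (sw S) (sw T).
move: (consensus T) (drift T) (sqdist (sw S) (sw T)) tri => c d s tri s0 d0 c0' e1 e2.
have : lam * c <= c by nra.
have : 0 <= c4 * c by exact: Rmult_le_pos.
have : 0 <= cq * c by exact: Rmult_le_pos.
have : 0 <= cq * d by exact: Rmult_le_pos.
have : 0 <= c4 * s by exact: Rmult_le_pos.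
lra.
Qed.

(** The direction is the gradient at [S], plus an exit-minus-table term, plus the averaged table
    error. Each part is bounded by the errors alone: this is the variance reduction. *)
Lemma direction_sq_le : exists2 B, 0 <= B & forall S T m, balanced S -> balanced T ->
  vdot (direction S T m) (direction S T m)
  <= B * (sqdist (sw S) wstar + sqdist (sw T) wstar + consensus S + consensus T
          + drift S + drift T).
Proof.
have [B1 B1_0 gB] := grad_risk_sq_le HK; have [B2 B2_0 eB] := exit_err_now.
have H0 := feature_energy_ge0.
have d0 : 0 <= Hs * (delta * delta) by apply: Rmult_le_pos => //; nra.
have dB := Rmult_le_pos _ _ d0 B2_0.
exists (2 * B1 + 16 * (Hs * (delta * delta) * B2) + 12 * (Hs * (delta * delta))); first lra.
move=> S T m bS bT.
pose b k := dQ (exit_tab T m k) (gamma m) - dQ (su S m k) (gamma m).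
pose x : Vec M := fun k j => b k * h m k j.
pose y : Vec M := vscale (/ INR N) (feature_comb (fun n k =>
   dQ (su S n k) (gamma n) - dQ (outputs (sw S) n k) (gamma n))).
have dx : vdot (direction S T m) (direction S T m) <=
    2 * vdot (gR (sw S)) (gR (sw S)) + 2 * vdot (vadd x y) (vadd x y).
  apply: vdot_split2 => k j.
  have := grad_risk_diff_feature (sw S) (fun n k => dQ (su S n k) (gamma n)) k j.
  rewrite /direction /x /y /b /vadd /vscale {1}/feature_comb; lra.
have xy : vdot (vadd x y) (vadd x y) <= 2 * vdot x x + 2 * vdot y y by apply: vdot_split2.
have yy : vdot y y <= _ := feature_comb_dQ_le (su S) (outputs (sw S)).
have xx : vdot x x <= Hs * blkdot b b by apply: (feature_row_le m).
have bb : blkdot b b <= delta * delta * sqdist (exit_tab T) (su S : tab).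
  apply: (Rle_trans _ (delta * delta *
    blkdot (vsub (exit_tab T) (su S : tab) m) (vsub (exit_tab T) (su S : tab) m))).
    by rewrite /blkdot -osum_scal; apply: osum_le => k; exact: dQ_sq_le.
  apply: Rmult_le_compat_l; first nra.
  by apply: (osum_term_le _ (fun n => blkdot (vsub (exit_tab T) (su S : tab) n)
       (vsub (exit_tab T) (su S : tab) n))) => n; exact: blkdot_ge0.
have tri := sqdist_triangle _ _ (outputs (sw S)) (exit_tab T) (su S : tab).
rewrite (sqdistC _ _ (outputs (sw S)) (su S : tab)) in tri.
have te := table_err S bS; have ee := eB S T bT; have ge := gB (sw S).
have wt := sqdist_triangle _ _ wstar (sw S) (sw T).
rewrite (sqdistC _ _ wstar) in wt.
have := consensus_ge0 T; have := drift_ge0 T; have := consensus_ge0 S; have := drift_ge0 S.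
have := sqdist_ge0 _ _ (sw S) wstar; have := sqdist_ge0 _ _ (sw T) wstar.
move: (consensus T) (drift T) (consensus S) (drift S) (sqdist (sw S) wstar)
  (sqdist (sw T) wstar) te ee ge wt => cT dT cS dS wS wT te ee ge wt wT0 wS0 dS0 cS0 dT0 cT0.
set G := wS + wT + cS + cT + dS + dT.
have G0 : 0 <= G by rewrite /G; lra.
have ee' : sqdist (exit_tab T) (outputs (sw S)) <= 2 * (B2 * G).
  by apply: Rle_trans ee _; have := Rmult_le_compat_l B2 (cT + dT + sqdist (sw S) (sw T)) (2 * G) B2_0;
    rewrite /G; lra.
have te' : sqdist (su S : tab) (outputs (sw S)) <= G by rewrite /G; lra.
have ge' : B1 * wS <= B1 * G by apply: Rmult_le_compat_l; rewrite // /G; lra.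
have xx' : vdot x x <= Hs * (delta * delta) * (4 * (B2 * G) + 2 * G).
  apply: Rle_trans xx _; rewrite Rmult_assoc; apply: Rmult_le_compat_l => //.
  apply: Rle_trans bb _; apply: Rmult_le_compat_l; [nra | lra].
have yy' : vdot y y <= Hs * (delta * delta) * G.
  by apply: Rle_trans yy _; apply: Rmult_le_compat_l.
have HG := Rmult_le_pos _ _ d0 G0.
lra.
Qed.

(** Row [m] trades its dispersion for that of its exit value; averaging over [m] replaces a fraction
    [1/N] of the total. *)
Lemma consensus_step mu S T : balanced T ->
  / INR N * osum (fun m => consensus (next mu S T m)) <=
  (1 - / INR N) * consensus S + / INR N * (lam * consensus T + c4 * drift T).
Proof.
move=> bT.
have E m : consensus (next mu S T m)
    = consensus S + (dispersion (exit_tab T m) - dispersion (su S m)).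
  rewrite /consensus -(osum_update _ m (fun n => dispersion (exit_tab T n))).
  by apply: osum_ext => n; rewrite /next /=; case: eqP => [->|].
rewrite (osum_ext _ _ _ E) osum_add osum_const osum_sub -/(consensus S).
have [n0 n1] := INR_Ninv; have N1 := INR_N_ge1.
have le : osum (fun m => dispersion (exit_tab T m)) <= lam * consensus T + c4 * drift T.
  rewrite /consensus /drift /sqdist /vdot -!osum_scal -osum_add.
  by apply: osum_le => n; exact: exit_dispersion.
have := Rmult_le_compat_l _ _ _ (Rlt_le _ _ n0) le.
have : / INR N * INR N = 1 by field; lra.
move: (osum _) (/ INR N) => e i iN.
rewrite (_ : i * (INR N * _ + _) = i * INR N * consensus S + i * e - i * consensus S); last ring.
rewrite iN; lra.
Qed.

Lemma sqdist_next mu S T m :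
  sqdist (sw (next mu S T m)) (sw S) = mu * mu * vdot (direction S T m) (direction S T m).
Proof.
rewrite /sqdist /vdot -osum_scal; apply: osum_ext => k.
by rewrite /blkdot -osum_scal; apply: osum_ext => j; rewrite /vsub /next /=; ring.
Qed.

(** Refreshing removes on average a fraction [1/N] of the drift. The kept rows are charged for the
    new move by Young with weight [1/N], chosen so that [(1 + 1/N)(1 - 1/N) = 1 - 1/N^2] still
    contracts. The fresh row carries only its age in the pipeline and the last move. *)
Lemma drift_step : exists2 B, 0 <= B & forall mu S T,
  / INR N * osum (fun m => drift (next mu S T m)) <=
  (1 - / INR N * / INR N) * drift S
  + B * (/ INR N * osum (fun m => sqdist (sw (next mu S T m)) (sw S))
         + sqdist (sw S) (sw T)).
Proof.
have q0 := record_const_ge0; have N1 := INR_N_ge1; have [n0 n1] := INR_Ninv.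
have qN : 0 <= cq * INR N by apply: Rmult_le_pos => //; lra.
exists (2 * cq + (1 + INR N) * cq); first lra.
move=> mu S T.
pose d n := blkdot (vsub (sv S : tab) (records (sw S)) n) (vsub (sv S : tab) (records (sw S)) n).
have dE : drift S = osum d by [].
have dm m : drift (next mu S T m) <= (1 + / INR N) * (drift S + (0 - d m))
    + (1 + INR N) * (cq * sqdist (sw (next mu S T m)) (sw S))
    + 2 * (cq * sqdist (sw S) (sw T)).
  set S' := next mu S T m.
  apply: (Rle_trans _ ((1 + / INR N) * osum (fun n => if n == m then 0 else d n)
     + (1 + INR N) * sqdist (records (sw S)) (records (sw S'))
     + 2 * sqdist (records (sw T)) (records (sw S)))); last first.
    rewrite (osum_update _ m (fun=> 0) d) -dE.
    have l1 := records_lip (sw S) (sw S'); have l2 := records_lip (sw T) (sw S).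
    rewrite (sqdistC _ _ (sw S)) in l1; rewrite (sqdistC _ _ (sw T)) in l2.
    have := Rmult_le_compat_l (1 + INR N) _ _ (Rplus_le_le_0_compat _ _ Rle_0_1 (pos_INR N)) l1.
    by lra.
  rewrite /drift /sqdist /vdot -!osum_scal -!osum_add; apply: osum_le => n.
  have R1_0 := blkdot_ge0 _ (vsub (records (sw S)) (records (sw S')) n).
  have R2_0 := blkdot_ge0 _ (vsub (records (sw T)) (records (sw S)) n).
  case: (eqVneq n m) => [nm|/negPf nm].
    have yg : blkdot (vsub (sv S' : tab) (records (sw S')) n) (vsub (sv S' : tab) (records (sw S')) n)
        <= (1 + 1) * blkdot (vsub (records (sw T)) (records (sw S)) n) (vsub (records (sw T)) (records (sw S)) n)
         + (1 + / 1) * blkdot (vsub (records (sw S)) (records (sw S')) n) (vsub (records (sw S)) (records (sw S')) n).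
      by apply: blkdot_young; [lra | move=> k; rewrite /vsub nm /S' /= eqxx; ring].
    by rewrite Rinv_1 in yg; nra.
  have yg : blkdot (vsub (sv S' : tab) (records (sw S')) n) (vsub (sv S' : tab) (records (sw S')) n)
      <= (1 + / INR N) * d n
       + (1 + / / INR N) * blkdot (vsub (records (sw S)) (records (sw S')) n) (vsub (records (sw S)) (records (sw S')) n).
    by apply: blkdot_young => // k; rewrite /vsub /S' /= nm; ring.
  by rewrite Rinv_inv in yg; lra.
have avg : / INR N * osum (fun m => drift (next mu S T m)) <= / INR N *
    osum (fun m => (1 + / INR N) * (drift S + (0 - d m))
    + (1 + INR N) * (cq * sqdist (sw (next mu S T m)) (sw S))
    + 2 * (cq * sqdist (sw S) (sw T))).
  by apply: Rmult_le_compat_l; [lra | exact: osum_le].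
apply: Rle_trans avg _.
rewrite !osum_add !osum_scal osum_add !osum_const osum_sub osum_const -dE.
have iN : / INR N * INR N = 1 by field; lra.
have D0 := drift_ge0 S; have s0 := sqdist_ge0 _ _ (sw S) (sw T).
have X0 : 0 <= / INR N * osum (fun m => sqdist (sw (next mu S T m)) (sw S)).
  by apply: Rmult_le_pos; [lra | apply: osum_ge0 => m; exact: sqdist_ge0].
move: (osum _) (drift S) (sqdist _ _) D0 s0 X0 => X D s D0 s0 X0.
rewrite (_ : / INR N * _ = (1 + / INR N) * (/ INR N * INR N * D - / INR N * D)
  + (1 + INR N) * (cq * (/ INR N * X)) + / INR N * INR N * (2 * (cq * s))); last ring.
rewrite iN; have := Rmult_le_pos _ _ q0 X0; have := Rmult_le_pos _ _ q0 s0.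
have := Rmult_le_pos _ _ qN s0; lra.
Qed.

Lemma dist_step : exists2 B, 0 <= B & forall mu S T, 0 < mu -> balanced T ->
  / INR N * osum (fun m => sqdist (sw (next mu S T m)) wstar) <=
  (1 - mu * nu) * sqdist (sw S) wstar
  + mu * (B * (consensus T + drift T + sqdist (sw S) (sw T)))
  + / INR N * osum (fun m => sqdist (sw (next mu S T m)) (sw S)).
Proof.
have [B2 B2_0 eB] := exit_err_now; have H0 := feature_energy_ge0.
have d0 : 0 <= Hs * (delta * delta) by apply: Rmult_le_pos => //; nra.
have nu0 := Rinv_0_lt_compat _ Hnu; have [n0 n1] := INR_Ninv; have N1 := INR_N_ge1.
exists (/ nu * (Hs * (delta * delta) * B2)).
  by do 2?apply: Rmult_le_pos => //; lra.
move=> mu S T mu0 bT; pose e := vsub (sw S) wstar.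
have E m : sqdist (sw (next mu S T m)) wstar = sqdist (sw S) wstar
    - 2 * mu * vdot e (direction S T m) + sqdist (sw (next mu S T m)) (sw S).
  rewrite /sqdist /vdot -osum_scal -osum_sub -osum_add; apply: osum_ext => k.
  rewrite /blkdot -osum_scal -osum_sub -osum_add; apply: osum_ext => j.
  by rewrite /e /vsub /next /=; ring.
rewrite (osum_ext _ _ _ E) osum_add osum_sub osum_const osum_scal.
pose b : Vec M := vscale (/ INR N) (feature_comb (fun n k =>
   dQ (exit_tab T n k) (gamma n) - dQ (outputs (sw S) n k) (gamma n))).
have iN : / INR N * INR N = 1 by field; lra.
(* Averaged over [m], the derivatives at [su S] cancel, so the bias [b] involves only the exit
   values. *)
have avgE : / INR N * osum (fun m => vdot e (direction S T m)) = vdot e (vadd (gR (sw S)) b).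
  rewrite vdot_wsum_avg; apply: vdot_ext => // k j.
  have := grad_risk_diff_feature (sw S) (fun n k => dQ (exit_tab T n k) (gamma n)) k j.
  rewrite /direction /vadd /b /vscale => <-.
  rewrite !osum_add !osum_const /feature_comb.
  rewrite (osum_ext _ (fun m => (_ - _) * _) (fun m => dQ (exit_tab T m k) (gamma m) * h m k j
     - dQ (su S m k) (gamma m) * h m k j)); last by move=> m; ring.
  rewrite osum_sub.
  set x := osum (fun m => dQ (exit_tab T m k) _ * _).
  set y := osum (fun m => dQ (su S m k) _ * _); set z := grad_r _ _ _.
  transitivity (/ INR N * (x - y) + (/ INR N * INR N) * (/ INR N * y) + (/ INR N * INR N) * z).
    ring.
  by rewrite iN; ring.
have str : nu * sqdist (sw S) wstar <= vdot e (gR (sw S)).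
  have := Hstrong (sw S) wstar; rewrite -/(sqdist _ _) -/e vdotC.
  rewrite (vdot_ext _ _ e e (vsub _ _) (gR (sw S))) //; first lra.
  by move=> k j; rewrite /vsub grad_risk_min; ring.
have bb : vdot b b <= _ := feature_comb_dQ_le (exit_tab T) (outputs (sw S)).
have ee := Rmult_le_compat_l _ _ _ d0 (eB S T bT).
(* The sign turns the upper bound into a lower bound on the inner product of [e] and [b]; the weight
   [nu] spends half of the strong convexity. *)
have yg := vdot_le_young _ _ nu e (vscale (-1) b) Hnu.
have nb : vdot (vscale (-1) b) (vscale (-1) b) <= 1 * vdot b b.
  by apply: vdot_le => k j; rewrite /vscale; lra.
rewrite vdotZ in yg; rewrite vdotD in avgE.
have nbb := Rmult_le_compat_l _ _ _ (Rlt_le _ _ nu0) (Rle_trans _ _ _ bb ee).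
have nb' := Rmult_le_compat_l _ _ _ (Rlt_le _ _ nu0) nb.
rewrite (_ : / INR N * _ = / INR N * INR N * sqdist (sw S) wstar
  - 2 * mu * (/ INR N * osum (fun m => vdot e (direction S T m)))
  + / INR N * osum (fun m => sqdist (sw (next mu S T m)) (sw S))); last ring.
rewrite iN avgE.
have W : vdot e e = sqdist (sw S) wstar by [].
rewrite W in yg.
suff key : nu * sqdist (sw S) wstar <= 2 * (vdot e (gR (sw S)) + vdot e b)
    + / nu * (Hs * (delta * delta) * B2) * (consensus T + drift T + sqdist (sw S) (sw T)).
  by have := Rmult_le_compat_l _ _ _ (Rlt_le _ _ mu0) key; lra.
lra.
Qed.

(** * The trajectory of the algorithm *)

Variable nb : rel 'I_K.
Hypothesis Ha_nonneg : forall l k : 'I_K, 0 <= a l k.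
Hypothesis Ha_supp : forall l k : 'I_K, 0 < a l k -> l = k \/ nb l k.

(** Off the graph the entries of [a] are nonnegative and not positive, so restricting the sum to
    neighbours changes nothing. *)
Lemma zitem_iter ns prev t j :
  zitem h a nb ns prev t j = iter j (combine a)
    (fun k => su (prev t) (ns t) k + prec h ns prev t k - sv (prev t) (ns t) k).
Proof.
elim: j => [|j IH]; first by apply: functional_extensionality.
apply: functional_extensionality => k; rewrite iterS -IH.
apply: osum_ext => l; case: ifPn => // /norP [/eqP lk /negP lnb].
have -> : a l k = 0; last ring.
case: (Ha_nonneg l k) => // /Ha_supp [|] //.
Qed.

Section Trajectory.
Variable mu : R.

Local Notation trj := (traj h gamma dQ grad_r a nb J mu).
Local Notation st := (state h gamma dQ grad_r a nb J mu).

Lemma traj_state ns m t : (t <= m.+1)%N -> trj ns m t = st ns t.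
Proof.
elim: m t => [|m IH] t; first by case: t => [|[|]].
rewrite leq_eqVlt ltnS => /orP [/eqP -> | tm].
  by rewrite /state; rewrite -[RHS]/(if (m.+2 <= m.+2)%N then trj ns m.+1 m.+2 else _) leqnn.
by rewrite /= tm IH.
Qed.

Lemma state_step ns i :
  st ns i.+2 = step h gamma dQ grad_r a nb J mu ns i.+1 (trj ns i).
Proof.
transitivity (if (i.+2 <= i.+2)%N then trj ns i.+1 i.+2
  else step h gamma dQ grad_r a nb J mu ns i.+2 (trj ns i.+1)); first exact: erefl.
rewrite leqnn.
transitivity (if (i.+2 <= i.+1)%N then trj ns i i.+2
  else step h gamma dQ grad_r a nb J mu ns i.+1 (trj ns i)); first exact: erefl.
by rewrite ltnn.
Qed.

(** Iterations before [J] leave the state alone, so the first state that can differ is the one at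
    [J+1]. *)
Lemma state_init ns i : (i <= J)%N -> st ns i = init_st.
Proof.
case: i => // i; elim: i => // i IH iJ.
by rewrite state_step /step iJ traj_state // IH // ltnW.
Qed.

Lemma state_next ns i : (J <= i)%N ->
  st ns i.+1 = next mu (st ns i) (st ns (i - J).+1) (ns (i - J).+1).
Proof.
move=> Ji; case: i Ji => [|i] Ji; first by move: (leq_trans HJ Ji).
have tle : ((i.+1 - J).+1 <= i.+1)%N by rewrite ltn_subrL HJ.
rewrite state_step /step ltnNge Ji zitem_iter /prec !traj_state //.
Qed.

(** By time [i] only the indices [n_1, ..., n_{i-J}] have left the pipeline; those still inside have
    not touched the state. *)
Lemma state_agree ns ns' i :
  (forall t, (0 < t)%N -> (t + J <= i)%N -> ns t = ns' t) -> st ns i = st ns' i.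
Proof.
elim/ltn_ind: i => i IH eq_ns; case: (leqP i J) => [iJ|]; first by rewrite !state_init.
case: i IH eq_ns => // i IH eq_ns; rewrite ltnS => Ji; rewrite (state_next ns i) // (state_next ns' i) //.
have ti : ((i - J).+1 <= i)%N by rewrite ltn_subrL HJ (leq_trans HJ Ji).
rewrite (eq_ns (i - J).+1) ?addSn ?subnK //.
rewrite (IH i) // => [|t t0 tJ]; last by apply: eq_ns; rewrite // ltnW.
rewrite (IH (i - J).+1) // => t t0 tJ; apply: eq_ns => //.
by apply: leq_trans tJ (leq_trans ti (leqnSn i)).
Qed.

Lemma balanced_state ns i : balanced (st ns i).
Proof.
elim/ltn_ind: i => i IH; case: (leqP i J) => [iJ|]; first by rewrite state_init.
case: i IH => // i IH; rewrite ltnS => Ji; rewrite state_next //.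
have ti : ((i - J).+1 <= i)%N by rewrite ltn_subrL HJ (leq_trans HJ Ji).
by apply: next_balanced; apply: IH.
Qed.

Variables (d0 : 'I_N) (L : nat).
Local Notation E := (expect_first d0 L).

(* The index consumed at iteration [i] was drawn at iteration [i - J + 1] and
   is independent of all states up to time [i]. *)
Lemma expect_next (F : St N K M -> St N K M -> R) i : (J <= i)%N -> (i < L)%N ->
  E (fun ns => F (st ns i) (st ns i.+1)) =
  E (fun ns => / INR N *
    osum (fun m => F (st ns i) (next mu (st ns i) (st ns (i - J).+1) m))).
Proof.
move=> Ji iL; have ti : ((i - J).+1 <= i)%N by rewrite ltn_subrL HJ (leq_trans HJ Ji).
rewrite (expect_resample _ HN d0 L (i - J).+1); last first.
  by rewrite /= (leq_trans ti (ltnW iL)).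
apply: expect_ext => ns; congr (_ * _); apply: osum_ext => m.
have agree s : (s <= i)%N -> st (resample _ ns (i - J).+1 m) s = st ns s.
  move=> si; apply: state_agree => t t0 tJ; rewrite /resample /=.
  case: eqP => // tE; have := leq_trans tJ si.
  by rewrite -(prednK t0) tE addSn subnK // ltnn.
by rewrite state_next // !agree // /resample eqxx.
Qed.

End Trajectory.

(** * Mean-square recursions along the trajectory *)

Lemma average_le (f : 'I_N -> R) c : (forall m, f m <= c) -> / INR N * osum f <= c.
Proof.
move=> fc; have [n0 _] := INR_Ninv; have N1 := INR_N_ge1.
have := Rmult_le_compat_l _ _ _ (Rlt_le _ _ n0) (osum_le _ _ (fun=> c) fc).
by rewrite osum_const -Rmult_assoc Rinv_l; lra.
Qed.

Lemma consensus_init : consensus (init_st : St N K M) = 0.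
Proof.
rewrite /consensus (osum_ext _ _ (fun=> 0)) ?osum_const; first ring.
move=> n; rewrite /dispersion /blkdot (osum_ext _ _ (fun=> 0)) ?osum_const; first ring.
by move=> k; rewrite /centered /mean /= osum_const /Rdiv; ring.
Qed.

Lemma drift_init : drift (init_st : St N K M) = 0.
Proof.
rewrite /drift -[RHS](sqdistxx _ _ (sv (init_st : St N K M) : tab)); apply: vdot_ext => n k;
  rewrite /vsub /records /blkdot /= (osum_ext _ _ (fun=> 0)) ?osum_const; try ring;
  by move=> j; ring.
Qed.

Section MeanSquare.
Variables (mu : R) (d0 : 'I_N) (L : nat).
Local Notation st := (state h gamma dQ grad_r a nb J mu).
Local Notation E := (expect_first d0 L).

(** The window has [J - 1] moves. Adding one turns a bound [y] into [2 y + 2 xb], whence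
    [(2^(d+1) - 2) xb] after [d] moves. *)
Lemma expect_window_move i xb : (J <= i)%N ->
  (forall s, (i < s + J)%N -> (s <= i)%N ->
    E (fun ns => sqdist (sw (st ns s.+1)) (sw (st ns s))) <= xb) ->
  E (fun ns => sqdist (sw (st ns i)) (sw (st ns (i - J).+1))) <= (2 ^ J - 2) * xb.
Proof.
move=> Ji Xle; set t := (i - J).+1.
have iE : i = (t + J.-1)%N by rewrite /t addSnnS prednK // subnK.
suff win d : (t + d <= i)%N ->
    E (fun ns => sqdist (sw (st ns (t + d)%N)) (sw (st ns t))) <= (2 ^ d.+1 - 2) * xb.
  by have := win J.-1; rewrite -iE prednK //; apply.
elim: d => [|d IH] td.
  rewrite addn0 (expect_ext _ _ _ _ (fun=> 0)) => [|ns]; last exact: sqdistxx.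
  by rewrite expect_const //=; lra.
rewrite addnS in td; have {}IH := IH (ltnW td).
have Xd : E (fun ns => sqdist (sw (st ns (t + d).+1)) (sw (st ns (t + d)%N))) <= xb.
  apply: Xle; last exact: ltnW.
  by rewrite iE -addnA ltn_add2l addnC -{2}(prednK HJ) addSn ltnS leq_addr.
apply: (Rle_trans _ (2 * E (fun ns => sqdist (sw (st ns (t + d).+1)) (sw (st ns (t + d)%N)))
   + 2 * E (fun ns => sqdist (sw (st ns (t + d)%N)) (sw (st ns t))))); last first.
  by rewrite [2 ^ d.+2]/= -[2 * 2 ^ d]/(2 ^ d.+1); lra.
rewrite addnS -!expect_scal -expect_add; apply: expect_le => // ns.
exact: sqdist_triangle.
Qed.

End MeanSquare.

(** [L] is independent of [i] so that one expectation serves all earlier iterations in the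
    induction. Each recursion is a one-step inequality, valid for every index sequence once the
    consumed index is averaged by [expect_next]. *)
Lemma mean_square_convergence : exists2 mubar, 0 < mubar & forall mu, 0 < mu <= mubar ->
  0 <= 1 - mu * nu / 5 /\ forall (d0 : 'I_N) L i, (i <= L)%N ->
  expect_first d0 L
    (fun ns => sqdist (sw (state h gamma dQ grad_r a nb J mu ns i)) wstar)
  <= 2 * sqdist (fun _ _ => 0) wstar * (1 - mu * nu / 5) ^ i.
Proof.
have [B1 B1_0 dirB] := direction_sq_le; have [B2 B2_0 driftB] := drift_step.
have [B3 B3_0 distB] := dist_step; have c4_0 := track_const_ge0.
pose B := B1 + B2 + B3 + c4.
have [B1B B2B B3B c4B] : [/\ B1 <= B, B2 <= B, B3 <= B & c4 <= B] by rewrite /B; split; lra.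
have B0 : 0 <= B by lra.
have n01 := INR_Ninv.
have cJ0 : 0 <= 2 ^ J - 2.
  have := Rle_pow 2 1 J _ (leP HJ); rewrite pow_1; lra.
have [mubar mubar0 adm] := small_step_admissible J nu _ lam B (2 ^ J - 2) Hnu n01 Hlam01.
exists mubar => // mu mu_le; have mu0 := proj1 mu_le; have {}adm := adm mu mu_le.
split.
  case: adm => -[[_ a2] _] _; have nn : / INR N * / INR N <= 1 by nra.
  by lra.
move=> d0 L i iL.
pose st := state h gamma dQ grad_r a nb J mu.
pose E := expect_first d0 L.
pose Y i := E (fun ns => sqdist (sw (st ns i)) (sw (st ns (i - J).+1))).
pose X i := E (fun ns => sqdist (sw (st ns i.+1)) (sw (st ns i))).
pose D i := E (fun ns => drift (st ns i)).
pose C i := E (fun ns => consensus (st ns i)).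
pose W i := E (fun ns => sqdist (sw (st ns i)) wstar).
have bal := balanced_state mu.
case: (delayed_recursion_bounds J nu (/ INR N) lam B (2 ^ J - 2) HJ Hnu n01 Hlam01 B0 cJ0
   mu mu0 adm L (sqdist (fun _ _ => 0) wstar) W C D X Y (sqdist_ge0 _ _ _ _) _ _ _ _ _ _ _ i iL) => //.
- move=> s sJ; split.
  + rewrite /W /E (expect_ext _ _ _ _ (fun=> sqdist (sw (init_st : St N K M)) wstar)).
      by rewrite expect_const.
    by move=> ns; rewrite /st state_init.
  + rewrite /C /E (expect_ext _ _ _ _ (fun=> 0)); first by rewrite expect_const.
    by move=> ns; rewrite /st state_init // consensus_init.
  + rewrite /D /E (expect_ext _ _ _ _ (fun=> 0)); first by rewrite expect_const.
    by move=> ns; rewrite /st state_init // drift_init.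
- move=> s sJ; rewrite /X /E (expect_ext _ _ _ _ (fun=> 0)); first by rewrite expect_const.
  by move=> ns; rewrite /st (state_init _ _ s) ?(state_init _ _ s.+1) ?sqdistxx // ltnW.
- move=> s Js sL t; rewrite /X /E /st.
  rewrite (expect_next mu d0 L (fun S S' => sqdist (sw S') (sw S)) s Js sL).
  rewrite /W /C /D /E -!expect_add -!expect_scal; apply: expect_le => // ns.
  apply: average_le => m; rewrite sqdist_next; apply: Rmult_le_compat_l; first nra.
  apply: Rle_trans (dirB _ _ m (bal ns s) (bal ns t)) _; apply: Rmult_le_compat_r => //.
  have := consensus_ge0 (st ns s); have := consensus_ge0 (st ns t).
  have := drift_ge0 (st ns s); have := drift_ge0 (st ns t).
  have := sqdist_ge0 _ _ (sw (st ns s)) wstar; have := sqdist_ge0 _ _ (sw (st ns t)) wstar.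
  rewrite /st; lra.
- move=> s xb Js sL Xle; exact: expect_window_move.
- move=> s Js sL t; rewrite /W /E /st.
  rewrite (expect_next mu d0 L (fun S S' => sqdist (sw S') wstar) s Js sL).
  rewrite /X /E /st (expect_next mu d0 L (fun S S' => sqdist (sw S') (sw S)) s Js sL).
  rewrite /C /D /Y /E -/t -!expect_add -!expect_scal -!expect_add; apply: expect_le => // ns.
  apply: Rle_trans (distB mu _ _ mu0 (bal ns t)) _.
  apply: Rplus_le_compat_r; apply: Rplus_le_compat_l; apply: Rmult_le_compat_l; first lra.
  apply: Rmult_le_compat_r => //; rewrite /st.
  have := consensus_ge0 (st ns t); have := drift_ge0 (st ns t).
  have := sqdist_ge0 _ _ (sw (st ns s)) (sw (st ns t)); rewrite /st; lra.
- move=> s Js sL; rewrite /D /E /st.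
  rewrite (expect_next mu d0 L (fun S S' => drift S') s Js sL).
  rewrite /X /E /st (expect_next mu d0 L (fun S S' => sqdist (sw S') (sw S)) s Js sL).
  rewrite /Y /E -!expect_add -!expect_scal -!expect_add; apply: expect_le => // ns.
  apply: Rle_trans (driftB mu _ _) _; apply: Rplus_le_compat_l.
  apply: Rmult_le_compat_r => //; apply: Rplus_le_le_0_compat; last exact: sqdist_ge0.
  apply: Rmult_le_pos; first lra.
  by apply: osum_ge0 => m; exact: sqdist_ge0.
- move=> s Js sL t; rewrite /C /E /st.
  rewrite (expect_next mu d0 L (fun S S' => consensus S') s Js sL).
  rewrite /D /E -!expect_scal -!expect_add -!expect_scal -!expect_add; apply: expect_le => // ns.
  apply: Rle_trans (consensus_step mu _ _ (bal ns t)) _; apply: Rplus_le_compat_l.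
  apply: Rmult_le_compat_l; first lra; apply: Rplus_le_compat_l.
  by apply: Rmult_le_compat_r => //; exact: drift_ge0.
Qed.

End Algorithm.

Theorem theorem1
  (N K : nat) (M : 'I_K -> nat)
  (HN : (0 < N)%N) (HK : (0 < K)%N)
  (h : 'I_N -> Vec M) (gamma : 'I_N -> R)
  (Q dQ : R -> R -> R)
  (r : forall k : 'I_K, ('I_(M k) -> R) -> R)
  (grad_r : forall k : 'I_K, ('I_(M k) -> R) -> 'I_(M k) -> R)
  (a : 'I_K -> 'I_K -> R) (nb : rel 'I_K)
  (L delta eta nu lam : R) (wstar : Vec M) (J : nat)
  (* Q differentiable with derivative dQ *)
  (HdQ : forall (n : 'I_N) (z : R),
      derivable_pt_lim (fun z' => Q z' (gamma n)) z (dQ z (gamma n)))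
  (* (i) *)
  (HL : 0 < L) (Hdelta : 0 < delta)
  (HLip_Q : forall (n : 'I_N) (w1 w2 : Vec M),
      vnorm (vsub (gradQn h gamma dQ n w1) (gradQn h gamma dQ n w2))
        <= L * vnorm (vsub w1 w2))
  (Hdelta_Q : forall (n : 'I_N) (z1 z2 : R),
      Rabs (dQ z1 (gamma n) - dQ z2 (gamma n)) <= delta * Rabs (z1 - z2))
  (* (ii) r convex, with gradient grad_r which is eta-Lipschitz *)
  (Hr_grad : forall (k : 'I_K) (x d : 'I_(M k) -> R),
      derivable_pt_lim (fun s => r k (fun j => x j + s * d j)) 0
        (blkdot (grad_r k x) d))
  (Hr_convex : forall (x y : Vec M) (t : R), 0 <= t <= 1 ->
      rsum r (vadd (vscale t x) (vscale (1 - t) y))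
        <= t * rsum r x + (1 - t) * rsum r y)
  (Heta : 0 < eta)
  (Hr_Lip : forall x y : Vec M,
      vnorm (vsub (grad_rsum grad_r x) (grad_rsum grad_r y)) <= eta * vnorm (vsub x y))
  (* (iii) R nu-strongly convex, wstar its minimizer *)
  (Hnu : 0 < nu)
  (Hstrong : forall w1 w2 : Vec M,
      vdot (vsub (grad_risk h gamma dQ grad_r w1) (grad_risk h gamma dQ grad_r w2))
           (vsub w1 w2) >= nu * vdot (vsub w1 w2) (vsub w1 w2))
  (Hmin : forall w : Vec M, risk h gamma Q r wstar <= risk h gamma Q r w)
  (* (iv) graph and combination matrix *)
  (Hconn : forall k l : 'I_K, connect nb k l)
  (Ha_nonneg : forall l k : 'I_K, 0 <= a l k)
  (Ha_supp : forall l k : 'I_K, 0 < a l k -> l = k \/ nb l k)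
  (Ha_sym : forall l k : 'I_K, a l k = a k l)
  (Ha_stoch : forall l : 'I_K, osum (fun k => a l k) = 1)
  (Ha_diag : exists k : 'I_K, 0 < a k k)
  (Hlam : second_largest_eig_mag a lam) (Hlam01 : 0 < lam < 1)
  (* pipeline depth *)
  (HJ : (1 <= J)%N) :
  exists mubar : R, 0 < mubar /\
    forall mu : R, 0 < mu <= mubar ->
      exists C : R,
        forall (k : 'I_K) (i : nat), (0 < i)%N ->
          expect_first (Ordinal HN) i
            (fun ns => blkdot (vsub (w_iter h gamma dQ grad_r a nb J mu ns i) wstar k)
                              (vsub (w_iter h gamma dQ grad_r a nb J mu ns i) wstar k))
          <= (Rmax (1 - (1 - lam ^ J) / (2 * INR N)) (1 - mu * nu / 5)) ^ i * C.
Proof.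
have [mubar mubar0 conv] := mean_square_convergence N K M HN h gamma Q dQ r grad_r
  delta eta nu wstar HdQ Hdelta_Q Hr_grad Heta Hr_Lip Hmin HK Hnu Hstrong a lam J
  Ha_sym Ha_stoch Hlam Hlam01 HJ nb Ha_nonneg Ha_supp.
exists mubar; split=> // mu /conv [rho0 bound].
(* Twice the initial squared distance, as the iterates start at 0. *)
exists (2 * sqdist (fun _ _ => 0) wstar) => k i i0.
apply: Rle_trans (_ : _ <= 2 * sqdist (fun _ _ => 0) wstar * (1 - mu * nu / 5) ^ i) _.
  apply: Rle_trans (bound (Ordinal HN) i i (leqnn i)).
  apply: expect_le => // ns; rewrite /sqdist /vdot.
  by apply: (osum_term_le _ (fun k => blkdot (vsub _ wstar k) (vsub _ wstar k))) => l;
    exact: blkdot_ge0.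
rewrite Rmult_comm; apply: Rmult_le_compat_r.
  by have := sqdist_ge0 _ _ (fun _ _ => 0) wstar; lra.
by apply: pow_incr; split=> //; exact: Rmax_r.
Qed.
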